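(* Let $d>0$, $\boldsymbol{x}_{\rm s}=(-d,0)^\top$, $\boldsymbol{x}_{\rm d}=(d,0)^\top$, and $\widehat{s}(\boldsymbol{x})=\max\{\|\boldsymbol{x}_{\rm s}-\boldsymbol{x}\|,\|\boldsymbol{x}-\boldsymbol{x}_{\rm d}\|\}$ for $\boldsymbol{x}\in\mathbb{R}^2$. Let $\Phi$ be an isotropic Poisson point process on $\mathbb{R}^2$ with mean measure $\Lambda$, and let $\Gamma_{\rm opt}=\min_{\boldsymbol{X}\in\Phi}\widehat{s}(\boldsymbol{X})$. Then the cumulative distribution function of $\Gamma_{\rm opt}$ is $$F_{\Gamma_{\rm opt}}(\gamma)=\begin{cases}0 & \text{if }\gamma<d,\\ 1-\exp\left(-\frac{2}{\pi}\int_0^{\frac{\pi}{2}}\Lambda\left(\mathcal{B}\left(\boldsymbol{0},\sqrt{\gamma^2-d^2\sin^2\theta}-d\cos\theta\right)\right)d\theta\right) & \text{if }\gamma\ge d,\end{cases}$$ where $\mathcal{B}(\boldsymbol{0},r)$ is the closed disc centered at the origin with radius $r$. Further, if $\Lambda$ is absolutely continuous with respect to the Lebesgue measure with a continuous Radon–Nikodym derivative $\lambda(\boldsymbol{x})$, $\boldsymbol{x}\in\mathbb{R}^2$, then $\lambda$ is a spherically symmetric function, i.e. $\lambda(\boldsymbol{x})=\lambda(\|\boldsymbol{x}\|)$ for all $\boldsymbol{x}\in\mathbb{R}^2$, and the probability density function of $\Gamma_{\rm opt}$ is $$f_{\Gamma_{\rm opt}}(\gamma)=4\int_0^{\frac{\pi}{2}}\frac{\gamma\left(\sqrt{\gamma^2-d^2\sin^2\theta}-d\cos\theta\right)}{\sqrt{\gamma^2-d^2\sin^2\theta}}\,\lambda\left(\sqrt{\gamma^2-d^2\sin^2\theta}-d\cos\theta\right)d\theta\cdot\exp\left(-4\int_0^{\frac{\pi}{2}}\int_0^{\sqrt{\gamma^2-d^2\sin^2\theta}-d\cos\theta}\lambda(\psi)\,\psi\,d\psi\,d\theta\right)\cdot\mathbf{1}_{\{\gamma\ge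 d\}}.$$
   Context: $\|\cdot\|$ is the Euclidean norm; $\mathbf{1}_{\{\cdot\}}$ is an indicator function. The mean measure of $\Phi$ is $\Lambda(\mathcal{S})=\mathsf{E}\left[\sum_{\boldsymbol{X}\in\Phi}\mathbf{1}_{\{\boldsymbol{X}\in\mathcal{S}\}}\right]$ for Borel $\mathcal{S}\subseteq\mathbb{R}^2$, assumed finite on bounded sets (so $\Phi$ is locally finite). $\Phi$ is isotropic if $\Lambda(\mathcal{S})=\Lambda(\Pi(\mathcal{S}))$ for all rotations $\Pi$ around the origin and all Borel $\mathcal{S}\subseteq\mathbb{R}^2$. With a slight abuse of notation, a spherically symmetric $\lambda$ is written as a function of the single variable $\|\boldsymbol{x}\|$. If $\Phi$ is empty, the minimum is taken to be $+\infty$, so $\Gamma_{\rm opt}$ may have a defective distribution (positive mass at $+\infty$); the density $f_{\Gamma_{\rm opt}}$ then describes the distribution restricted to finite values. *)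

(* Defs.v *)
From HB Require Import structures.
From mathcomp Require Export all_boot all_order all_algebra.
From mathcomp Require Export all_classical all_reals all_analysis.
From mathcomp Require Export measurable_realfun.
Export numFieldNormedType.Exports.

Set Implicit Arguments.
Unset Strict Implicit.
Unset Printing Implicit Defensive.
Import Order.TTheory GRing.Theory Num.Theory.

Local Open Scope classical_set_scope.
Local Open Scope ring_scope.

(* The plane is R * R with its product topology and product (= Borel)
   sigma-algebra. Its library norm is the max-norm, hence enorm below; bounded
   sets and continuity are the same for both norms. *)
Section plane.
Context {R : realType}.
Implicit Types (x : R * R) (r d t : R).

Definition enorm x : R := Num.sqrt (x.1 ^+ 2 + x.2 ^+ 2).

Definition disc r : set (R * R) := [set x | enorm x <= r].

Definition rotation t x : R * R :=
  (cos t * x.1 - sin t * x.2, sin t * x.1 + cos t * x.2).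

Definition src d : R * R := (- d, 0).
Definition dst d : R * R := (d, 0).
Definition shat d x : R := Num.max (enorm (src d - x)) (enorm (x - dst d)).

(* distance from the origin to the boundary of [set x | shat d x <= gamma] in
   the directions theta, - theta and their opposites, for 0 <= theta <= pi / 2
   and d <= gamma *)
Definition polar_radius d (gamma theta : R) : R :=
  Num.sqrt (gamma ^+ 2 - d ^+ 2 * sin theta ^+ 2) - d * cos theta.

(* the one-variable function r |-> lam r of a spherically symmetric lam *)
Definition radial (lam : R * R -> R) r : R := lam (r, 0).

End plane.

Section point_processes.
Context {disp : measure_display} {Omega : measurableType disp} {R : realType}.

(* A point process is a random locally finite multiset of points:
   mult w x is the multiplicity of x in the configuration drawn at w. Multiple
   points are allowed because the mean measure may have an atom (for an
   isotropic one, at the origin). *)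
Definition count_in (mult : Omega -> R * R -> nat) (S : set (R * R))
    (w : Omega) : \bar R :=
  (\esum_(x in S) (mult w x)%:R%:E)%E.

Record point_process := PointProcess {
  mult :> Omega -> R * R -> nat ;
  mult_locally_finite : forall (w : Omega) (S : set (R * R)),
    bounded_set S -> finite_set [set x | S x /\ (0 < mult w x)%N] ;
  measurable_count_in : forall S : set (R * R),
    measurable S -> measurable_fun setT (count_in mult S) }.

Definition points (Phi : point_process) (w : Omega) : set (R * R) :=
  [set x | (0 < Phi w x)%N].

Definition mean_measure (P : probability Omega R) (Phi : point_process)
    (S : set (R * R)) : \bar R :=
  (\int[P]_w count_in Phi S w)%E.

Definition independent_family (P : probability Omega R) (n : nat)
    (X : 'I_n -> Omega -> \bar R) :=
  forall B : 'I_n -> set (\bar R), (forall i, measurable (B i)) ->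
    P (\bigcap_i (X i @^-1` B i)) = (\prod_(i < n) P (X i @^-1` B i))%E.

(* The second argument of poisson_prob is a dummy. *)
Definition is_poisson_process (P : probability Omega R) (Phi : point_process) :=
  (forall S : set (R * R), measurable S -> (mean_measure P Phi S < +oo)%E ->
     forall k : nat, P [set w | count_in Phi S w = k%:R%:E] =
       poisson_prob (fine (mean_measure P Phi S)) 0 [set k]) /\
  (forall (n : nat) (S : 'I_n -> set (R * R)),
     (forall i, measurable (S i)) -> trivIset setT S ->
     independent_family P (fun i => count_in Phi (S i))).

Definition locally_finite_measure (Lambda : set (R * R) -> \bar R) :=
  forall S : set (R * R), measurable S -> bounded_set S -> (Lambda S < +oo)%E.

Definition isotropic (Lambda : set (R * R) -> \bar R) :=
  forall (t : R) (S : set (R * R)), measurable S ->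
    Lambda S = Lambda (rotation t @` S).

Definition has_density (Lambda : set (R * R) -> \bar R) (lam : R * R -> R) :=
  forall S : set (R * R), measurable S ->
    Lambda S = (\int[lebesgue_measure \x lebesgue_measure]_(x in S) (lam x)%:E)%E.

(* The infimum of set0 is +oo; otherwise this is a minimum
   (gamma_opt_attained). *)
Definition gamma_opt (d : R) (Phi : point_process) (w : Omega) : \bar R :=
  ereal_inf [set (shat d x)%:E | x in points Phi w].

End point_processes.
Arguments point_process {disp} Omega R.

Section extended_random_variables.
Context {disp : measure_display} {Omega : measurableType disp} {R : realType}.
Variable P : probability Omega R.

Definition ecdf (X : {RV P >-> \bar R}) (r : R) : \bar R :=
  distribution P X `]-oo, r%:E].

(* density of the restriction of the law of X to the finite values, which may
   have total mass less than 1 *)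
Definition is_pdf (X : {RV P >-> \bar R}) (f : R -> R) :=
  [/\ measurable_fun setT f, (forall r, 0 <= f r) &
    forall A : set R, measurable A ->
      distribution P X (EFin @` A) = (\int[lebesgue_measure]_(r in A) (f r)%:E)%E].

End extended_random_variables.
Arguments ecdf {disp Omega R} P X r.
Arguments is_pdf {disp Omega R} P X f.

Section gamma_opt_facts.
Context {disp : measure_display} {Omega : measurableType disp} {R : realType}.
Implicit Types (Phi : point_process Omega R) (d : R).

Let ler_norm_enorm1 (x : R * R) : `|x.1| <= enorm x.
Proof. by rewrite -sqrtr_sqr ler_wsqrtr// lerDl sqr_ge0. Qed.

Let ler_norm_enorm2 (x : R * R) : `|x.2| <= enorm x.
Proof. by rewrite -sqrtr_sqr ler_wsqrtr// lerDr sqr_ge0. Qed.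

Let measurable_enorm : measurable_fun setT (@enorm R).
Proof.
apply: measurableT_comp.
  by apply: continuous_measurable_fun; exact: sqrt_continuous.
by apply: measurable_funD; apply: measurable_funX;
  [exact: measurable_fst|exact: measurable_snd].
Qed.

Let measurable_shat d : measurable_fun setT (shat d).
Proof.
apply: measurable_maxr; apply: measurableT_comp measurable_enorm _;
  apply/measurable_fun_pairP; split => /=.
- exact: measurable_funB measurable_fst.
- exact: measurable_funB measurable_snd.
- exact: measurable_funB measurable_fst _.
- exact: measurable_funB measurable_snd _.
Qed.

Let bounded_shat d c : bounded_set [set x | shat d x <= c].
Proof.
exists (c + `|d|); split; first exact: num_real.
move=> M cM x /=; rewrite /shat ge_max => /andP[_ xc].
apply: ltW; apply: le_lt_trans cM.
rewrite prod_normE ge_max; apply/andP; split.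
- have := ler_norm_enorm1 (x - dst d); rewrite /= => h.
  by rewrite -[x.1](subrK d) (le_trans (ler_normD _ _))// lerD2r (le_trans h).
- have := ler_norm_enorm2 (x - dst d); rewrite /= subr0 => h.
  by rewrite (le_trans h)// (le_trans xc)// lerDl.
Qed.

Let count_in_gt0 Phi (S : set (R * R)) w :
  (0 < count_in Phi S w)%E <-> exists2 x, S x & points Phi w x.
Proof.
split=> [|[x Sx px]].
  apply: contraPP => noS.
  rewrite /count_in esum1 ?ltxx// => x Sx.
  have [->//|x0] := posnP (Phi w x).
  by case: noS; exists x.
apply: (@lt_le_trans _ _ (Phi w x)%:R%:E); first by rewrite lte_fin ltr0n.
apply: esum_ge; exists [set x]; last by rewrite fsbig_set1.
by split; [exact: finite_set1|move=> _ ->].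
Qed.

Lemma measurable_gamma_opt d Phi : measurable_fun setT (gamma_opt d Phi).
Proof.
apply: (measurability _ (ErealGenCInfty.measurableE R)) => //.
move=> _ [_ [r ->] <-]; rewrite setTI.
have -> : gamma_opt d Phi @^-1` `[r%:E, +oo[ =
    ~` [set w | (0 < count_in Phi [set x | (shat d x < r)%R] w)%E].
  apply/seteqP; split => w /=.
    rewrite in_itv/= andbT => rg /count_in_gt0[x /= xr px].
    have : (gamma_opt d Phi w <= (shat d x)%:E)%E.
      by apply: ereal_inf_lbound; exists x.
    by move=> /(le_trans rg); rewrite lee_fin leNgt xr.
  move=> h; rewrite in_itv/= andbT leNgt; apply/negP.
  move=> /ereal_inf_ltP[_ [x px <-]]; rewrite lte_fin => xr; apply: h.
  by apply/count_in_gt0; exists x.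
apply: measurableC; rewrite -[X in measurable X]setTI.
apply: emeasurable_fun_o_infty => //; apply: measurable_count_in.
rewrite -[X in measurable X]setTI; have := @measurable_shat d.
move=> /(_ measurableT `]-oo, r[%classic (measurable_itv _)).
by congr (measurable (_ `&` _)); apply/seteqP; split => x /=; rewrite in_itv.
Qed.

HB.instance Definition _ d Phi :=
  isMeasurableFun.Build _ _ _ _ (gamma_opt d Phi) (measurable_gamma_opt d Phi).

Lemma gamma_opt_attained d Phi w : points Phi w !=set0 ->
  exists2 x, points Phi w x & gamma_opt d Phi w = (shat d x)%:E.
Proof.
move=> [x0 px0]; pose c := shat d x0.
have seqmin (s : seq (R * R)) : x0 \in s ->
    exists2 x, x \in s & forall y, y \in s -> shat d x <= shat d y.
  elim: s x0 {px0 c} => // a [_ x0 _|b s ih x0 _].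
    by exists a; rewrite ?mem_head// => y; rewrite inE => /eqP ->.
  have [x xs xmin] := ih b (mem_head _ _).
  have [ax|xa] := leP (shat d a) (shat d x).
    exists a; first exact: mem_head.
    by move=> y; rewrite inE => /predU1P[->//|/xmin]; exact: le_trans.
  exists x; first by rewrite inE xs orbT.
  by move=> y; rewrite inE => /predU1P[->|/xmin//]; exact: ltW.
have /finite_seqP[s sE] := mult_locally_finite Phi w (@bounded_shat d c).
have sP y : y \in s <-> shat d y <= c /\ points Phi w y.
  by have /seteqP[h1 h2] := sE; split=> [/h2//|/h1].
have [x xs xmin] := seqmin s (iffRL (sP x0) (conj (lexx _) px0)).
have [xc px] := iffLR (sP x) xs.
exists x => //; apply/eqP; rewrite eq_le; apply/andP; split.
  by apply: ereal_inf_lbound; exists x.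
apply: le_ereal_inf_tmp => _ [y py <-]; rewrite lee_fin.
have [yc|cy] := leP (shat d y) c; first by apply: xmin; apply/sP.
by rewrite (le_trans xc)// ltW.
Qed.

End gamma_opt_facts.

(* Main.v *)
(* The event gamma_opt > gamma says that Phi has no point in the lens
   S = {shat <= gamma}, and squaring shows that x belongs to S iff
   |x|^2 + d^2 + 2 d |x.1| <= gamma^2. The void probability is exp(- Lambda S).
   By isotropy Lambda S is the average over t of the measure of the rotated
   lens; by Tonelli it is the Lambda-integral of the proportion of angles at
   which the circle through x lies in S, which by the symmetries of S is the
   proportion of theta in [0, pi / 2] with |x| <= polar_radius theta. A second
   use of Tonelli turns it into the average of Lambda over the discs of radius
   polar_radius theta.

   If Lambda has a continuous density lam, comparing Lambda on a small disc
   with its value on the rotated disc shows that lam is radial, without using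
   the rotation invariance of the planar Lebesgue measure. Comparing on thin
   annuli gives (Lambda (disc r))' = 2 pi r lam r. Differentiating under the
   integral sign gives the derivative of the distribution function on
   ]d, +oo[, and its continuity at d allows one to integrate it back. *)
Require Import Defs.
Import Order.TTheory GRing.Theory Num.Theory.
From HB Require Import structures.
From mathcomp Require Import ring lra.
Local Open Scope classical_set_scope.
Local Open Scope ring_scope.
Set Implicit Arguments.
Unset Strict Implicit.

Lemma measurable_preimage d d' (T : measurableType d) (T' : measurableType d')
  (f : T -> T') (A : set T') : measurable_fun setT f -> measurable A ->
  measurable (f @^-1` A).
Proof. by move=> mf mA; rewrite -[X in measurable X]setTI; exact: mf. Qed.

(** * Translations and reflections of the line *)

Section lebesgue_invariance.
Context {R : realType}.
Notation mu := (@lebesgue_measure R).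
Implicit Types (A E : set R) (a b c p t : R).

Lemma measurable_addl a : measurable_fun setT (fun t : R => a + t).
Proof. exact: measurable_funD. Qed.

(** Lebesgue measure is determined by its values on half-open intervals, and a translation carries
    such an interval to one of the same length. *)
Lemma lebesgue_measure_addl a A : measurable A ->
  mu ((fun t => a + t) @^-1` A) = mu A.
Proof.
move=> mA.
suff -> : mu A = pushforward mu ((fun t => a + t) : _ -> measurableTypeR R) A
  by [].
apply: lebesgue_measure_unique => //=; first exact: measurable_addl.
move=> mf _ [[b c]] _ <-; rewrite /pushforward/=.
have -> : (fun t => a + t) @^-1` `]b, c] = `]b - a, c - a]%classic.
  by apply/seteqP; split => t /=; rewrite !in_itv/= ltrBlDl lerBrDl.
by rewrite !lebesgue_measure_itv/= !lte_fin ltrD2r -!EFinB opprD opprK addrACA addNr addr0.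
Qed.

Lemma lebesgue_measure_subl a A : measurable A ->
  mu ((fun t => a - t) @^-1` A) = mu A.
Proof.
move=> mA.
rewrite -(lebesgue_measure_addl a mA) -[RHS]lebesgue_measureN//.
exact: measurable_preimage (measurable_addl a) mA.
Qed.

Lemma lebesgue_measure_itv_split a b c E : measurable E -> a <= b <= c ->
  mu (`]a, c] `&` E) = (mu (`]a, b] `&` E) + mu (`]b, c] `&` E))%E.
Proof.
move=> mE /andP[ab bc].
have mI (i : interval R) :
  measurable ([set` i] `&` E : set (measurableTypeR R)) by exact: measurableI.
rewrite -measureU//.
- rewrite -setIUl; congr (mu (_ `&` _)).
  apply/seteqP; split => t /=; rewrite !in_itv/=.
    by move=> /andP[bt te]; case: (leP t b) => tc; [left|right]; rewrite ?bt.
  by move=> [|] /andP[] => [bt tc|ct te]; apply/andP; split => //; lra.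
- apply/seteqP; split => t //=; rewrite !in_itv/= => -[[/andP[_ tc] _] [/andP[ct _] _]].
  by move: ct; rewrite ltNge tc.
Qed.

(** Translation turns the window into []a, a + p]]. Cutting it at [p] and moving the piece beyond
    [p] back by one period restores []0, p]]. It serves for the period [pi] of |cos|. *)
Lemma lebesgue_measure_periodic p a E : measurable E -> 0 <= a <= p ->
  (forall t, E (p + t) <-> E t) ->
  mu (`]0, p] `&` (fun t => a + t) @^-1` E) = mu (`]0, p] `&` E).
Proof.
move=> mE /andP[a0 ap] Ep.
have mI (i : interval R) :
  measurable ([set` i] `&` E : set (measurableTypeR R)) by exact: measurableI.
have -> : `]0, p] `&` (fun t => a + t) @^-1` E =
    (fun t => a + t) @^-1` (`]a, a + p] `&` E).
  apply/seteqP; split => t /=; rewrite !in_itv/=.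
    by move=> [/andP[t0 tp] Et]; split => //; rewrite ltrDl t0 lerD2l.
  by rewrite ltrDl lerD2l.
rewrite lebesgue_measure_addl; last exact: mI.
rewrite (@lebesgue_measure_itv_split a p (a + p))// ?lerDr ?ap ?a0//.
rewrite (@lebesgue_measure_itv_split 0 a p)// ?lerDr ?ap ?a0//.
rewrite addeC; congr (_ + _)%E.
rewrite -(@lebesgue_measure_addl p); last exact: mI.
congr (mu _).
apply/seteqP; split => t /=; rewrite !in_itv/= [a + p]addrC ltrDl lerD2l => -[tI Et];
  by split => //; apply/Ep.
Qed.

(** The reflection in [p] carries the right half of the interval onto the left half, up to an
    endpoint. It serves for |cos| with [p] equal to [pi / 2]. *)
Lemma lebesgue_measure_symmetric p E : measurable E -> 0 <= p ->
  (forall t, E (p + p - t) <-> E t) ->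
  mu (`]0, p + p] `&` E) = (2%:E * mu (`]0%R, p] `&` E))%E.
Proof.
move=> mE p0 Ep.
have mI (i : interval R) :
  measurable ([set` i] `&` E : set (measurableTypeR R)) by exact: measurableI.
rewrite (@lebesgue_measure_itv_split 0 p (p + p))// ?p0 ?lerDl//.
rewrite (_ : 2%:E = 1%:E + 1%:E)%E; last by rewrite -EFinD.
rewrite ge0_muleDl// !mul1e; congr (_ + _)%E.
rewrite -(@lebesgue_measure_subl (p + p)); last exact: mI.
have -> : (fun t => p + p - t) @^-1` (`]p, p + p] `&` E) = `[0, p[ `&` E.
  apply/seteqP; split => t /=; rewrite !in_itv/=.
    by move=> [/andP[h1 h2] /Ep Et]; split => //; apply/andP; split; lra.
  by move=> [/andP[h1 h2] Et]; split; [apply/andP; split; lra|apply/Ep].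
(* A single point is null, so the reflected half [[0, p[] may be closed to [[0, p]] and then opened
   at 0. *)
have itvU (i j : interval R) x : [set` i] = [set` j] `|` [set x] ->
    mu ([set` i] `&` E) = mu ([set` j] `&` E).
  have mS : measurable ([set x] `&` E : set (measurableTypeR R)) by exact: measurableI.
  move=> ->; rewrite setIUl measureU0//.
  apply/eqP; rewrite -measure_le0 -(lebesgue_measure_set1 x).
  by apply: le_measure; rewrite ?inE.
rewrite -(itvU `[0, p] `[0, p[ p); last by rewrite setUitv1 ?bnd_simp.
by rewrite -(itvU `[0, p] `]0, p] 0)// setUC setU1itv ?bnd_simp.
Qed.
End lebesgue_invariance.

(** * Geometry of the lens *)

Section plane_geometry.
Context {R : realType}.
Notation mu := (@lebesgue_measure R).
Implicit Types (x : R * R) (d g r t : R).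

Lemma enorm_ge0 x : 0 <= enorm x.
Proof. exact: sqrtr_ge0. Qed.

Lemma enorm_sqr x : enorm x ^+ 2 = x.1 ^+ 2 + x.2 ^+ 2.
Proof. by rewrite sqr_sqrtr// addr_ge0 ?sqr_ge0. Qed.

Lemma enorm_le x r : 0 <= r -> (enorm x <= r) = (x.1 ^+ 2 + x.2 ^+ 2 <= r ^+ 2).
Proof. by move=> r0; rewrite -enorm_sqr ler_sqr ?nnegrE ?enorm_ge0. Qed.

Lemma enorm_rotation t x : enorm (rotation t x) = enorm x.
Proof.
rewrite /enorm /rotation/=; congr Num.sqrt.
have := cos2Dsin2 t; move: (cos t) (sin t) => c s cs.
transitivity ((c ^+ 2 + s ^+ 2) * (x.1 ^+ 2 + x.2 ^+ 2)); first by ring.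
by rewrite cs mul1r.
Qed.

Lemma rotationD t u x : rotation t (rotation u x) = rotation (t + u) x.
Proof. by rewrite /rotation cosD sinD/=; congr (_, _); ring. Qed.

Lemma rotation0 x : rotation 0 x = x.
Proof. by case: x => a b; rewrite /rotation cos0 sin0/=; congr (_, _); ring. Qed.

Lemma rotationB t x y : rotation t (x - y) = rotation t x - rotation t y.
Proof. by apply/eqP; rewrite xpair_eqE/=; apply/andP; split; apply/eqP; ring. Qed.

Lemma rotation_image t (S : set (R * R)) :
  rotation t @` S = rotation (- t) @^-1` S.
Proof.
apply/seteqP; split=> [_ [x Sx <-]|x Sx] /=.
  by rewrite rotationD addNr rotation0.
by exists (rotation (- t) x) => //; rewrite rotationD addrN rotation0.
Qed.

(** The squared distances to the two foci are |x|^2 + d^2 + 2 d x.1 and |x|^2 + d^2 - 2 d x.1; the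
    larger one has |x.1| in the last term. *)
Lemma shat_le d g x : 0 < d -> 0 <= g ->
  (shat d x <= g) = (enorm x ^+ 2 + d ^+ 2 + 2 * d * `|x.1| <= g ^+ 2).
Proof.
move=> d0 g0; rewrite /shat ge_max !enorm_le//= enorm_sqr.
case: x => a b /=; apply/andP/idP => [[h1 h2]|].
  by have [a0|a0] := ger0P a; nra.
by have [a0|a0] := ger0P a => h; split; nra.
Qed.

Lemma shat_ge d x : 0 < d -> d <= shat d x.
Proof.
move=> d0; rewrite leNgt; apply/negP => h.
have s0 : 0 <= shat d x by rewrite /shat le_max enorm_ge0.
(* With [g] taken to be [shat d x] itself, [shat_le] bounds d^2 by the square of [shat d x]. *)
have := lexx (shat d x); rewrite {1}shat_le// => h2.
have := sqr_ge0 (enorm x); have := normr_ge0 x.1; nra.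
Qed.

(** Completing the square turns the lens inequality in polar coordinates into (r + d cos t)^2 <= g^2
    - d^2 sin^2 t; [polar_radius] is the nonnegative root of the corresponding equation. *)
Lemma le_polar_radius d g r t : 0 < d -> d <= g -> 0 <= r -> 0 <= cos t ->
  (r <= polar_radius d g t) = (r ^+ 2 + d ^+ 2 + 2 * d * (r * cos t) <= g ^+ 2).
Proof.
move=> d0 dg r0 c0; rewrite /polar_radius lerBrDr.
have -> : g ^+ 2 - d ^+ 2 * sin t ^+ 2 = g ^+ 2 - d ^+ 2 + (d * cos t) ^+ 2.
  by rewrite sin2cos2; ring.
have e0 : 0 <= g ^+ 2 - d ^+ 2 + (d * cos t) ^+ 2.
  by rewrite addr_ge0 ?sqr_ge0// subr_ge0 ler_sqr ?nnegrE// ltW// (lt_le_trans d0).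
have f0 : 0 <= r + d * cos t by rewrite addr_ge0// mulr_ge0// ltW.
rewrite -(@ler_sqr _ _ (Num.sqrt _)) ?nnegrE ?sqrtr_ge0// sqr_sqrtr//.
by apply/idP/idP => h; nra.
Qed.

Lemma polar_radius_ge0 d g t : 0 < d -> d <= g -> 0 <= cos t ->
  0 <= polar_radius d g t.
Proof.
move=> d0 dg c0; rewrite le_polar_radius// mul0r mulr0 expr0n/= add0r addr0.
by rewrite ler_sqr ?nnegrE//; lra.
Qed.

(* The sign keeps the angle in [0, pi], one period of |cos|. *)
Lemma polar_angle x : exists2 a, 0 <= a <= pi &
  (x = (enorm x * cos a, enorm x * sin a)) \/
  (x = (- (enorm x * cos a), - (enorm x * sin a))).
Proof.
have [x0|x0] := eqVneq (enorm x) 0.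
  exists 0; first by rewrite lexx pi_ge0.
  have := enorm_sqr x; rewrite x0 expr0n/= => /esym/eqP.
  rewrite paddr_eq0 ?sqr_ge0// !sqrf_eq0 => /andP[/eqP h1 /eqP h2].
  by left; rewrite !mul0r [x]surjective_pairing h1 h2.
have xp : 0 < enorm x by rewrite lt_neqAle eq_sym x0 enorm_ge0.
(* In the upper half-plane [acos] recovers the angle. A point of the lower half-plane is negated,
   which exchanges the two alternatives. *)
wlog x2 : x x0 xp / 0 <= x.2.
  move=> H; have [/H//|x2] := leP 0 x.2; first exact.
  have eN : enorm (- x) = enorm x by rewrite /enorm/= !sqrrN.
  have [|||a aI] := H (- x); rewrite ?eN//=; first by lra.
  move=> E; exists a => //; move: E => [|] /(congr1 -%R); rewrite opprK => E.
    by right.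
  by left; rewrite {1}E; congr (_, _); rewrite /= opprK.
pose c := x.1 / enorm x.
have cI : -1 <= c <= 1.
  rewrite -ler_norml /c normrM normfV [`|enorm x|]ger0_norm ?enorm_ge0//.
  rewrite ler_pdivrMr// mul1r -ler_sqr ?nnegrE ?enorm_ge0//.
  by rewrite enorm_sqr real_normK ?num_real// lerDl sqr_ge0.
exists (acos c); first by rewrite acos_ge0// acos_lepi.
left; rewrite acosK ?in_itv//= sin_acos// {1}[x]surjective_pairing.
congr (_, _); first by rewrite /c mulrC divfK.
rewrite -[x.2]ger0_norm// -sqrtr_sqr.
rewrite -[X in X * _]ger0_norm ?enorm_ge0// -sqrtr_sqr -sqrtrM ?sqr_ge0//.
congr Num.sqrt; rewrite mulrBr /c expr_div_n mulr1 mulrC divfK ?sqrf_eq0//.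
by rewrite enorm_sqr [X in X - _]addrC addrK.
Qed.

End plane_geometry.

Lemma measurable_sublevel d (T : measurableType d) (R : realType) (f : T -> R) c :
  measurable_fun setT f -> measurable [set x | f x <= c].
Proof.
move=> mf; have -> : [set x | f x <= c] = f @^-1` `]-oo, c].
  by apply/seteqP; split => x; rewrite /= in_itv.
exact: measurable_preimage.
Qed.

(** * Proportion of angles at which a circle lies in the lens *)

Section angle.
Context {R : realType}.
Notation mu := (@lebesgue_measure R).
Implicit Types (x : R * R) (d g r t : R).

Lemma measurable_cos : measurable_fun setT (@cos R).
Proof. apply: continuous_measurable_fun; exact: continuous_cos. Qed.

Lemma measurable_sin : measurable_fun setT (@sin R).
Proof. apply: continuous_measurable_fun; exact: continuous_sin. Qed.

Lemma measurable_sqrt : measurable_fun setT (@Num.sqrt R).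
Proof. apply: continuous_measurable_fun; exact: sqrt_continuous. Qed.

(** If [x] has polar angle [a], up to sign, membership of the rotated point in the lens depends only
    on |cos (a + t)|. The period [pi] removes [a], and the symmetry about [pi / 2] leaves a
    quadrant, counted twice, where cos is nonnegative. *)
Lemma angle_measure d g x : 0 < d -> d <= g ->
  mu (`]0, pi] `&` [set t | shat d (rotation t x) <= g]) =
  (2%:E * mu (`]0%R, (pi / 2)%R] `&` [set t | (enorm x <= polar_radius d g t)%R]))%E.
Proof.
move=> d0 dg; have g0 : 0 <= g by lra.
set r := enorm x; have r0 : 0 <= r by exact: enorm_ge0.
pose E := [set t | r ^+ 2 + d ^+ 2 + 2 * d * (r * `|cos t|) <= g ^+ 2].
have mE : measurable E.
  apply: measurable_sublevel; apply: measurable_funD => //.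
  do 2 apply: measurable_funM => //.
  exact: measurableT_comp measurable_cos.
have [a aI xa] := polar_angle x.
have -> : [set t | shat d (rotation t x) <= g] = (fun t => a + t) @^-1` E.
  suff H t : `|(rotation t x).1| = r * `|cos (a + t)|.
    by apply/seteqP; split => t; rewrite /= shat_le// enorm_rotation H.
  rewrite -[X in X * _]ger0_norm// -normrM cosD mulrBr !mulrA.
  by case: xa => -> /=; [|rewrite -normrN]; congr `|_|; rewrite -/r; ring.
rewrite lebesgue_measure_periodic//; last first.
  by move=> t; rewrite /E/= [pi + t]addrC cosDpi normrN.
have pih : pi / 2 + pi / 2 = pi :> R by field.
have pi0 := @pi_gt0 R.
rewrite -{1}pih lebesgue_measure_symmetric//; last 2 first.
- by lra.
- by move=> t; rewrite /E/= pih [pi - t]addrC cosDpi normrN cosN.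
congr (_ * mu _)%E; apply/seteqP; split => t [tI].
  move: (tI); rewrite /= in_itv/= => /andP[t1 t2] Et; split => //.
  have c0 : 0 <= cos t by apply: cos_ge0_pihalf; apply/andP; split; lra.
  by rewrite le_polar_radius//; move: Et; rewrite /E/= ger0_norm.
move: (tI); rewrite /= in_itv/= => /andP[t1 t2] Et; split => //.
have c0 : 0 <= cos t by apply: cos_ge0_pihalf; apply/andP; split; lra.
by move: Et; rewrite le_polar_radius// /E/= ger0_norm.
Qed.

End angle.

Section plane_measurability.
Context {R : realType}.
Implicit Types (x : (R * R)%type) (d g r t : R).

Lemma measurable_enorm : measurable_fun setT (@enorm R).
Proof.
apply: measurableT_comp measurable_sqrt _.
by apply: measurable_funD; apply: measurable_funX.
Qed.

Lemma measurable_disc r : measurable (disc r : set (R * R)).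
Proof. exact: measurable_sublevel measurable_enorm. Qed.

Lemma measurable_shat_le d g : 0 < d -> 0 <= g ->
  measurable [set x | shat d x <= g].
Proof.
move=> d0 g0; under eq_set do rewrite shat_le//.
apply: measurable_sublevel; apply: measurable_funD.
  by apply: measurable_funD => //; apply: measurable_funX; exact: measurable_enorm.
by apply: measurable_funM => //; exact: measurableT_comp.
Qed.

Lemma measurable_polar_radius d g : measurable_fun setT (polar_radius d g).
Proof.
apply: measurable_funB.
  apply: measurableT_comp measurable_sqrt _.
  apply: measurable_funB => //; apply: measurable_funM => //.
  by apply: measurable_funX; exact: measurable_sin.
by apply: measurable_funM => //; exact: measurable_cos.
Qed.

Lemma norm_le_enorm x : `|x| <= enorm x.
Proof.
rewrite prod_normE ge_max; apply/andP; split;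
  by rewrite -sqrtr_sqr ler_wsqrtr// (lerDl, lerDr) sqr_ge0.
Qed.

Lemma bounded_disc r : bounded_set (disc r : set (R * R)).
Proof.
exists r; split; first exact: num_real.
move=> M rM x /= xr; apply: ltW; apply: le_lt_trans rM.
by rewrite (le_trans (norm_le_enorm x)).
Qed.

Lemma bigcup_disc : \bigcup_n disc n%:R = [set: R * R].
Proof.
apply/seteqP; split => // x _; exists (Num.truncn (enorm x)).+1 => //.
by rewrite /disc/= ltW// truncnS_gt.
Qed.

End plane_measurability.

Section disc_monotone.
Context {R : realType}.
Variable L : {measure set (R * R) -> \bar R}.
Hypothesis L_fin : forall r, L (disc r) \is a fin_num.

Lemma le_disc_mass : {homo (fun r => fine (L (disc r))) : r s / r <= s}.
Proof.
move=> r s rs; apply: fine_le => //.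
apply: le_measure; rewrite ?inE; [exact: measurable_disc..|].
by move=> x xr; exact: le_trans xr rs.
Qed.

(** The mass of a disc is monotone in its radius, hence a Borel function of it, even where it
    jumps. *)
Lemma measurable_disc_mass d g :
  measurable_fun setT (fun t => fine (L (disc (polar_radius d g t)))).
Proof.
apply: (@measurableT_comp _ _ _ _ _ _ (fun r => fine (L (disc r)))).
  exact: nondecreasing_measurable le_disc_mass.
exact: measurable_polar_radius.
Qed.

End disc_monotone.

(** * Averaging over rotations *)

Section rotation_average.
Local Open Scope ereal_scope.
Context {R : realType}.
Notation mu := (@lebesgue_measure R).
Variable L : {sigma_finite_measure set (R * R)%type -> \bar R}.
Hypothesis L_isotropic : isotropic L.
Implicit Types (x : (R * R)%type) (d g r t : R).

(* Tonelli on the sets of pairs (x, t) with [shat d (rotation t x) <= g] and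
   with [enorm x <= polar_radius d g t]. *)
Lemma rotation_average d g : (0 < d)%R -> (d <= g)%R ->
  pi%:E * L [set x | (shat d x <= g)%R] =
  2%:E * \int[mu]_(t in `]0%R, (pi / 2)%R]) L (disc (polar_radius d g t)).
Proof.
move=> d0 dg; have g0 : (0 <= g)%R by lra.
pose S := [set x | (shat d x <= g)%R].
have mS : measurable S by exact: measurable_shat_le.
pose A : set (R * R * measurableTypeR R)%type :=
  [set u | `]0%R, pi]%classic u.2 /\ S (rotation u.2 u.1)].
pose B : set (R * R * measurableTypeR R)%type :=
  [set u | `]0%R, (pi / 2)%R]%classic u.2 /\ (enorm u.1 <= polar_radius d g u.2)%R].
have m2 : measurable_fun setT (fun u : (R * R * measurableTypeR R)%type => (u.2 : R)).
  exact: measurable_snd.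
have m11 : measurable_fun setT (fun u : (R * R * measurableTypeR R)%type => u.1.1).
  exact: measurableT_comp measurable_fst measurable_fst.
have m12 : measurable_fun setT (fun u : (R * R * measurableTypeR R)%type => u.1.2).
  exact: measurableT_comp measurable_snd measurable_fst.
have mA : measurable A.
  apply: measurableI; first exact: (measurable_preimage m2).
  apply: (@measurable_preimage _ _ _ _
    (fun u : (R * R * measurableTypeR R)%type => rotation u.2 u.1) S) => //.
  have mc := measurableT_comp (@measurable_cos R) m2.
  have ms := measurableT_comp (@measurable_sin R) m2.
  by apply/measurable_fun_pairP; split => /=;
    [apply: measurable_funB|apply: measurable_funD]; apply: measurable_funM.
have mB : measurable B.
  apply: measurableI; first exact: (measurable_preimage m2).
  rewrite [X in measurable X](_ : _ =
    [set u : (R * R * measurableTypeR R)%type |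
      (enorm u.1 - polar_radius d g u.2 <= 0)%R]); last first.
    by apply/seteqP; split => u /=; rewrite subr_le0.
  apply: measurable_sublevel; apply: measurable_funB.
    exact: measurableT_comp measurable_enorm measurable_fst.
  exact: measurableT_comp (measurable_polar_radius d g) m2.
have := indic_fubini_tonelli L mu mA.
have := indic_fubini_tonelli L mu mB.
rewrite !indic_fubini_tonelli_FE// !indic_fubini_tonelli_GE//=.
have xA x : xsection A x = `]0%R, pi] `&` [set t | (shat d (rotation t x) <= g)%R].
  by apply/seteqP; split => t; rewrite /xsection/= inE.
have xB x : xsection B x = `]0%R, (pi / 2)%R] `&` [set t | (enorm x <= polar_radius d g t)%R].
  by apply/seteqP; split => t; rewrite /xsection/= inE.
have yA t : L (ysection A t) = ((fun=> L S) \_ `]0%R, pi]%classic) t.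
  rewrite patchE; case: ifPn => [|/negP] tI.
    (* The section at [t] is the preimage of [S] under the rotation by [t], that is, the image under
       the rotation by [- t], so isotropy gives it the mass of [S]. *)
    rewrite (L_isotropic (- t)%R mS) rotation_image opprK; congr (L _).
    apply/seteqP; split => x; rewrite /ysection/= inE; first by case.
    by move=> Sx; split => //; rewrite inE in tI.
  rewrite (_ : ysection A t = set0) ?measure0//.
  apply/seteqP; split => x //; rewrite /ysection/= inE => -[/= tI' _].
  by apply: tI; rewrite inE.
have yB t : L (ysection B t) =
    ((fun t => L (disc (polar_radius d g t))) \_ `]0%R, (pi / 2)%R]%classic) t.
  rewrite patchE; case: ifPn => [|/negP] tI.
    congr (L _).
    apply/seteqP; split => x; rewrite /ysection/= inE; first by case.
    by move=> Sx; split => //; rewrite inE in tI.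
  rewrite (_ : ysection B t = set0) ?measure0//.
  apply/seteqP; split => x //; rewrite /ysection/= inE => -[/= tI' _].
  by apply: tI; rewrite inE.
move=> hB hA.
have {}hB : \int[L]_x mu (`]0%R, (pi / 2)%R] `&` [set t | (enorm x <= polar_radius d g t)%R]) =
    \int[mu]_(t in `]0%R, (pi / 2)%R]) L (disc (polar_radius d g t)).
  rewrite [RHS]integral_mkcond; transitivity (\int[L]_x mu (xsection B x)).
    by apply: eq_integral => x _; congr (mu _); exact/esym/xB.
  by rewrite hB; apply: eq_integral => t _; rewrite -yB.
transitivity (\int[mu]_(t in `]0%R, pi]) L S).
  by rewrite integral_cst//= lebesgue_measure_itv/= lte_fin pi_gt0 oppr0 adde0 muleC.
transitivity (\int[L]_x mu (xsection A x)).
  by rewrite hA integral_mkcond; apply: eq_integral => t _; rewrite -yA.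
rewrite -hB -ge0_integralZl//; last first.
  have := measurable_fun_xsection mu mB; congr measurable_fun.
  by apply/funext => x; congr (mu _); exact: xB.
apply: eq_integral => x _; rewrite -angle_measure//; congr (mu _); exact: xA.
Qed.
End rotation_average.

(** * The mean measure of a point process as a sigma-finite measure *)

Section mean_measure.
Local Open Scope ereal_scope.
Context {disp : measure_display} {Omega : measurableType disp} {R : realType}.
Variables (P : probability Omega R) (Phi : point_process Omega R).

Lemma count_in_ge0 (S : set (R * R)%type) w : 0 <= count_in Phi S w.
Proof. by apply: esum_ge0 => x _; rewrite lee_fin. Qed.

Let L0 : mean_measure P Phi set0 = 0.
Proof. by apply: integral0_eq => w _; rewrite /count_in esum_set0. Qed.

Let L_ge0 S : 0 <= mean_measure P Phi S.
Proof. by apply: integral_ge0 => w _; exact: count_in_ge0. Qed.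

(** For each outcome the count is additive over disjoint sets, being a sum of nonnegative
    multiplicities; expectation commutes with series of nonnegative functions. *)
Let L_sigma_additive : semi_sigma_additive (mean_measure P Phi).
Proof.
move=> F mF tF mUF.
rewrite [X in _ --> X](_ : _ = \sum_(n <oo) mean_measure P Phi (F n)).
  exact: is_cvg_nneseries.
rewrite -integral_nneseries//; last 2 first.
- by move=> n; exact: measurable_count_in.
- by move=> n w _; exact: count_in_ge0.
apply: eq_integral => w _; rewrite nneseries_esumT; last by move=> n; exact: count_in_ge0.
by rewrite /count_in -esum_bigcupT// => x; rewrite lee_fin.
Qed.

HB.instance Definition _ := isMeasure.Build _ _ _ (mean_measure P Phi)
  L0 L_ge0 L_sigma_additive.

Hypothesis L_locally_finite : locally_finite_measure (mean_measure P Phi).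

Lemma mean_measure_disc_fin r : mean_measure P Phi (disc r) \is a fin_num.
Proof.
rewrite ge0_fin_numE//; apply: L_locally_finite; first exact: measurable_disc.
exact: bounded_disc.
Qed.

Let L_sigma_finite : sigma_finite setT (mean_measure P Phi).
Proof.
exists (fun n => disc n%:R); first by rewrite bigcup_disc.
move=> n; split; first exact: measurable_disc.
by rewrite -ge0_fin_numE// mean_measure_disc_fin.
Qed.

Hypothesis L_isotropic : isotropic (mean_measure P Phi).

Lemma mean_measure_rotation_average d g : (0 < d)%R -> (d <= g)%R ->
  pi%:E * mean_measure P Phi [set x | (shat d x <= g)%R] =
  2%:E * \int[lebesgue_measure]_(t in `]0%R, (pi / 2)%R])
    mean_measure P Phi (disc (polar_radius d g t)).
Proof.
pose L : {sigma_finite_measure set (R * R)%type -> \bar R} :=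
  HB.pack (mean_measure P Phi)
    (Measure_isSigmaFinite.Build _ _ _ (mean_measure P Phi) L_sigma_finite).
exact: (@rotation_average R L L_isotropic).
Qed.

Lemma mean_measure_shat_le d g : (0 < d)%R -> (d <= g)%R ->
  mean_measure P Phi [set x | (shat d x <= g)%R] =
  (2 / pi * \int[lebesgue_measure]_(t in `[0, (pi / 2)])
     fine (mean_measure P Phi (disc (polar_radius d g t))))%R%:E.
Proof.
move=> d0 dg; have g0 : (0 <= g)%R by lra.
(* The lens is bounded, so its mass is finite and the identity in the extended reals can be divided
   by [pi]. *)
have sub : [set x | (shat d x <= g)%R] `<=` disc g.
  move=> x; rewrite /= shat_le// /disc/= enorm_le// => h.
  have := enorm_sqr x; have := normr_ge0 x.1; nra.
have fin : mean_measure P Phi [set x | (shat d x <= g)%R] \is a fin_num.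
  rewrite ge0_fin_numE//; apply: le_lt_trans (le_measure _ _ _ sub) _; rewrite ?inE.
  - exact: measurable_shat_le.
  - exact: measurable_disc.
  - by rewrite -ge0_fin_numE// mean_measure_disc_fin.
have pi0 := @pi_gt0 R.
have := mean_measure_rotation_average d0 dg.
under eq_integral do rewrite -(fineK (mean_measure_disc_fin _)).
rewrite integral_itv_obnd_cbnd; last first.
  apply: measurable_funTS; apply/measurable_EFinP.
  exact: measurable_disc_mass mean_measure_disc_fin _ _.
rewrite /Rintegral -(fineK fin).
set I := \int[_]_(x in _) _; set m := fine (mean_measure _ _ _).
have : 0 <= I by apply: integral_ge0 => t _; rewrite lee_fin fine_ge0.
(* An infinite integral would contradict the finite mass of the lens. *)
case: I => [I| |]// _; last by rewrite mulry gtr0_sg// mul1e.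
rewrite -!EFinM => -[/= E]; congr (_%:E).
by rewrite mulrAC -E mulrAC divff ?mul1r// gt_eqF.
Qed.
End mean_measure.

(** * Void probability and the distribution function *)

Section gamma_opt_cdf.
Context {disp : measure_display} {Omega : measurableType disp} {R : realType}.
Variables (P : probability Omega R) (Phi : point_process Omega R) (d : R).
Hypothesis d_gt0 : 0 < d.

Lemma count_in_eq0 (S : set (R * R)) w :
  count_in Phi S w = 0%E <-> (forall x, S x -> ~ points Phi w x).
Proof.
split=> [h x Sx|h].
  have : ((Phi w x)%:R%:E <= count_in Phi S w)%E.
    apply: esum_ge; exists [set x]; last by rewrite fsbig_set1.
    by split; [exact: finite_set1|move=> _ ->].
  by rewrite h lee_fin (ler_nat _ _ 0) leqn0 /points/= lt0n => ->.
rewrite /count_in esum1// => x Sx; have := h _ Sx.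
by rewrite /points/= lt0n => /negP; rewrite negbK => /eqP ->.
Qed.

Lemma gamma_opt_ge w : (d%:E <= gamma_opt d Phi w)%E.
Proof. by apply: le_ereal_inf_tmp => _ [x _ <-]; rewrite lee_fin shat_ge. Qed.

(** The closed lens captures the weak inequality because the infimum is attained as soon as there is
    a point; without points it is +oo. *)
Lemma gamma_opt_le w g : (gamma_opt d Phi w <= g%:E)%E <->
  count_in Phi [set x | shat d x <= g] w <> 0%E.
Proof.
split=> [h /count_in_eq0 E|/count_in_eq0].
  have [p0|/set0P pn] := eqVneq (points Phi w) set0.
    by move: h; rewrite /gamma_opt p0 image_set0 ereal_inf0.
  have [x px] := gamma_opt_attained d pn.
  by move=> xE; move: h; rewrite xE lee_fin => /E.
move=> /existsNP[x /not_implyP[xg /contrapT px]].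
apply: (@le_trans _ _ (shat d x)%:E); last by rewrite lee_fin.
by apply: ereal_inf_lbound; exists x.
Qed.

Hypothesis Phi_poisson : is_poisson_process P Phi.

Lemma void_probability (S : set (R * R)) : measurable S ->
  (mean_measure P Phi S < +oo)%E ->
  P [set w | count_in Phi S w = 0%E] = (expR (- fine (mean_measure P Phi S)))%:E.
Proof.
move=> mS fS; rewrite -[0%E]/(0%:R%:E) Phi_poisson.1// /poisson_prob.
case: ifPn => [m0|].
  by rewrite esum_set1 ?lee_fin ?poisson_pmf_ge0// /poisson_pmf m0 expr0 fact0 invr1 !mul1r.
(* At a rate that is not positive [poisson_prob] is by default the Dirac mass at 0, in agreement
   with exp(0) = 1. *)
rewrite -leNgt => m0; have -> : fine (mean_measure P Phi S) = 0.
  by apply/eqP; rewrite eq_le m0 fine_ge0.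
by rewrite oppr0 expR0 diracE mem_set.
Qed.

Hypothesis L_locally_finite : locally_finite_measure (mean_measure P Phi).
Hypothesis L_isotropic : isotropic (mean_measure P Phi).

Lemma gamma_opt_cdf g :
  ecdf P (gamma_opt d Phi) g =
  (if g < d then 0
   else 1 - expR (- (2 / pi *
        \int[lebesgue_measure]_(theta in `[0, pi / 2])
          fine (mean_measure P Phi (disc (polar_radius d g theta))))))%:E.
Proof.
rewrite /ecdf /distribution /pushforward.
have [gd|dg] := ltP g d.
  rewrite (_ : _ @^-1` _ = set0) ?measure0//.
  apply/seteqP; split => w //=; rewrite in_itv/= => /(le_trans (gamma_opt_ge w)).
  by rewrite lee_fin leNgt gd.
pose S := [set x | shat d x <= g].
have mS : measurable S by apply: measurable_shat_le => //; exact: le_trans (ltW d_gt0) dg.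
rewrite (_ : _ @^-1` _ = ~` [set w | count_in Phi S w = 0%E]); last first.
  by apply/seteqP; split => w /=; rewrite in_itv/= gamma_opt_le.
have LS := mean_measure_shat_le L_locally_finite L_isotropic d_gt0 dg.
rewrite probability_setC; last first.
  rewrite (_ : [set w | _] = count_in Phi S @^-1` [set 0%E]); last by [].
  by apply: measurable_preimage => //; exact: measurable_count_in.
by rewrite void_probability// -/S LS ?ltry.
Qed.

End gamma_opt_cdf.

(** * Area of discs *)

Section area.
Context {R : realType}.
Notation mu := (@lebesgue_measure R).
Notation mu2 := (mu \x mu)%E.
Implicit Types (c : R * R) (a b d g r t : R).

(** Only one-sided limits are asked at the endpoints, since the primitives used below have a known
    derivative only to the right of the left endpoint. *)
Lemma FTC2_is_derive a b (f F : R -> R) : a < b ->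
  {within `[a, b], continuous f} -> F x @[x --> a^'+] --> F a ->
  F x @[x --> b^'-] --> F b ->
  (forall x, a < x < b -> is_derive x 1 F (f x)) ->
  (\int[mu]_(x in `[a, b]) (f x)%:E = (F b - F a)%:E)%E.
Proof.
move=> ab cf Fa Fb dF; rewrite (@continuous_FTC2 _ f F)// ?EFinB//.
- by split=> // x; rewrite in_itv/= => /dF [].
- by move=> x; rewrite in_itv/= derive1E => /dF [].
Qed.

(** By uniqueness of product measures it suffices to treat rectangles, where the translation acts on
    each side separately. *)
Lemma lebesgue2_shift c (X : set (R * R)) : measurable X ->
  mu2 ((fun x => c + x) @^-1` X) = mu2 X.
Proof.
move=> mX.
suff -> : mu2 X = pushforward mu2
    ((fun x => c + x) : _ -> (measurableTypeR R * measurableTypeR R)%type) X by [].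
have mc : measurable_fun setT (fun x : R * R => c + x).
  by apply/measurable_fun_pairP; split; apply: measurable_funD.
apply: product_measure_unique => // A B mA mB.
rewrite -[RHS]/(mu A * mu B)%E.
rewrite -(lebesgue_measure_addl c.1 mA) -(lebesgue_measure_addl c.2 mB).
by rewrite -product_measure1E//; [exact: measurable_preimage (measurable_addl _) mA|
  exact: measurable_preimage (measurable_addl _) mB].
Qed.

(** The integrand is the length of the vertical chord of the disc at abscissa [x]. The substitution
    x = r sin t makes the integral elementary. *)
Lemma integral_sqrt_circle r : 0 <= r ->
  (\int[mu]_x (2 * Num.sqrt (r ^+ 2 - x ^+ 2))%:E = (pi * r ^+ 2)%:E)%E.
Proof.
rewrite le_eqVlt => /predU1P[<-|r0].
  rewrite expr0n/= mulr0 integral0_eq// => x _.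
  by rewrite sub0r ler0_sqrtr ?mulr0// oppr_le0 sqr_ge0.
have pi0 := @pi_gt0 R.
pose F t := r * sin t.
have dF t : is_derive t 1 F (r * cos t) by apply: is_derive_eq.
have F'E : derive1 F = (fun t => r * cos t).
  by apply/funext => t; rewrite derive1E; have [] := dF t.
have cF : continuous F by move=> t; apply: cvgMr; exact: continuous_sin.
have cF' : continuous (derive1 F) by rewrite F'E => t; apply: cvgMr; exact: continuous_cos.
(* Beyond [r] in absolute value the radicand is negative and [Num.sqrt] is 0 by default, so the
   integral over the line reduces to one over [-r, r]. *)
transitivity (\int[mu]_(x in `[F (- (pi / 2))%R, F (pi / 2)%R])
    (2 * Num.sqrt (r ^+ 2 - x ^+ 2))%:E)%E.
  rewrite /F sinN sin_pihalf mulr1 mulrN1 [RHS]integral_mkcond.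
  apply: eq_integral => x _; rewrite patchE; case: ifPn => //.
  rewrite notin_setE/= in_itv/= -ler_norml => /negP; rewrite -ltNge => xr.
  rewrite ler0_sqrtr ?mulr0// subr_le0 -(real_normK (num_real x)).
  by rewrite ler_sqr ?nnegrE// ltW.
rewrite integration_by_substitution_increasing//.
- transitivity (\int[mu]_(t in `[(- (pi / 2))%R, (pi / 2)%R]) (r ^+ 2 * (2 * cos t ^+ 2))%:E)%E.
    apply: eq_integral => t; rewrite inE/= in_itv/= => tI; congr (_%:E).
    have c0 : 0 <= cos t by exact: cos_ge0_pihalf.
    rewrite F'E -[LHS]/(2 * Num.sqrt (r ^+ 2 - (r * sin t) ^+ 2) * (r * cos t)).
    have -> : r ^+ 2 - (r * sin t) ^+ 2 = (r * cos t) ^+ 2.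
      by rewrite !exprMn cos2sin2; ring.
    by rewrite sqrtr_sqr ger0_norm ?mulr_ge0 ?(ltW r0)//; ring.
  (* An explicit primitive of 2 r^2 cos^2 t, whose increment over the interval is pi r^2. *)
  have dG t : is_derive t 1 (fun t => r ^+ 2 * (t + sin t * cos t)) (r ^+ 2 * (2 * cos t ^+ 2)).
    apply: is_derive_eq; rewrite /GRing.scale/=.
    have := sin2cos2 t; rewrite expr2 => s2.
    by have -> : sin t * - sin t = cos t ^+ 2 - 1 by [rewrite mulrN s2; ring]; ring.
  have cc : {within `[(- (pi / 2)), (pi / 2)], continuous (fun t : R => r ^+ 2 * (2 * cos t ^+ 2))}.
    apply: continuous_subspaceT => t; do 2 apply: cvgMr.
    apply: (@cvg_comp _ _ _ cos (fun x => x ^+ 2)); first exact: continuous_cos.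
    exact: exprn_continuous.
  have cG : continuous (fun t : R => r ^+ 2 * (t + sin t * cos t)).
    move=> t; apply: cvgMr; apply: cvgD => //; apply: cvgM; first exact: continuous_sin.
    exact: continuous_cos.
  have pi2 : - (pi / 2) < pi / 2 :> R by lra.
  rewrite (FTC2_is_derive pi2 cc (cvg_at_right_filter (cG _))
    (cvg_at_left_filter (cG _)) (fun t _ => dG t)).
  by congr (_%:E); rewrite cos_pihalf cosN cos_pihalf !mulr0 !addr0; field.
- by lra.
- move=> s t sI tI st; rewrite /F ltr_pM2l//.
  by rewrite ltr_sin// -set_itvE ?inE.
- apply: cvgP; apply: cvg_at_right_filter; exact: cF'.
- apply: cvgP; apply: cvg_at_left_filter; exact: cF'.
- split.
  + by move=> t _; have [] := dF t.
  + exact/cvg_at_right_filter/cF.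
  + exact/cvg_at_left_filter/cF.
- apply: continuous_subspaceT => x; apply: cvgMr.
  apply: (@cvg_comp _ _ _ (fun x => r ^+ 2 - x ^+ 2) Num.sqrt).
    by apply: cvgB; [exact: cvg_cst|exact: exprn_continuous].
  exact: sqrt_continuous.
Qed.

Lemma lebesgue2_disc r : 0 <= r -> mu2 (disc r) = (pi * r ^+ 2)%:E.
Proof.
move=> r0; rewrite -integral_sqrt_circle//.
rewrite [LHS]/(\int[mu]_x mu (xsection (disc r) x))%E.
apply: eq_integral => x _; set s := Num.sqrt _.
have [xr|rx] := leP (x ^+ 2) (r ^+ 2).
  have -> : xsection (disc r) x = `[- s, s]%classic.
    apply/seteqP; split => y; rewrite /xsection/= inE /disc/= enorm_le// in_itv/= -ler_norml;
    rewrite -(@ler_sqr _ `|y|) ?nnegrE ?sqrtr_ge0// sqr_sqrtr ?subr_ge0//;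
    by rewrite real_normK ?num_real// lerBrDl.
  rewrite lebesgue_measure_itv/= lte_fin; case: ifPn => [_|ss].
    by rewrite -EFinB; congr (_%:E); ring.
  have := sqrtr_ge0 (r ^+ 2 - x ^+ 2); rewrite -/s => s0.
  by congr (_%:E); lra.
rewrite /s ler0_sqrtr ?mulr0; last by rewrite subr_le0 ltW.
rewrite (_ : xsection _ _ = set0) ?measure0//.
apply/seteqP; split => y //; rewrite /xsection/= inE /disc/= enorm_le//= => h.
have := sqr_ge0 y; lra.
Qed.

Lemma measurable_disc_at c r : measurable [set x : R * R | enorm (x - c) <= r].
Proof.
apply: measurable_sublevel; apply: measurableT_comp measurable_enorm _.
by apply/measurable_fun_pairP; split => /=; apply: measurable_funB.
Qed.

Lemma lebesgue2_disc_at c r : 0 <= r ->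
  mu2 [set x | enorm (x - c) <= r] = (pi * r ^+ 2)%:E.
Proof.
move=> r0; apply: etrans (lebesgue2_disc r0).
apply: etrans (lebesgue2_shift (- c) (measurable_disc r)).
by congr mu2; apply/seteqP; split => x; rewrite /disc/= addrC.
Qed.

End area.

(** * Measurability of open sets and continuous functions on the plane *)

Section continuous_measurable_plane.
Context {R : realType}.

Lemma rat_near (a e : R) : 0 < e -> exists q : rat, ball a e (ratr q).
Proof.
move=> e0; have [q qI] : exists q : rat, ratr q \in `]a - e, a + e[.
  by apply: rat_in_itvoo; rewrite ltrD2l; lra.
by exists q; rewrite ball_itv.
Qed.

(** An open set is a countable union of balls with rational centres and radii 1/(n+1). For the
    max-norm these balls are products of intervals, hence measurable rectangles. *)
Lemma open_measurable_plane (U : set (R * R)) : open U -> measurable U.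
Proof.
move=> oU.
pose B (p q : rat) (n : nat) : set (R * R) := ball (ratr p : R, ratr q : R) n.+1%:R^-1.
pose F p q n := if `[< B p q n `<=` U >] then B p q n else set0.
have -> : U = \bigcup_p \bigcup_q \bigcup_n F p q n.
  apply/seteqP; split => [x Ux|x [p _] [q _] [n _]]; last first.
    by rewrite /F; case: asboolP => // + Bx; exact.
  have /nbhs_ballP[e /= e0 xeU] : nbhs x U by exact: open_nbhs_nbhs.
  (* Half of [e], since a point of the rational ball is reached from [x] through its centre. *)
  have [n ne] : exists n, n.+1%:R^-1 < e / 2.
    exists (Num.truncn (e / 2)^-1); rewrite -[ltRHS]invrK ltf_pV2 ?posrE ?invr_gt0 ?divr_gt0//.
    exact: truncnS_gt.
  have n0 : 0 < n.+1%:R^-1 :> R by rewrite invr_gt0.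
  have [p xp] := rat_near x.1 n0; have [q xq] := rat_near x.2 n0.
  exists p => //; exists q => //; exists n => //.
  rewrite /F; case: asboolP => [_|]; first by split => /=; exact: ball_sym.
  move=> H; exfalso; apply: H => y [/= py qy]; apply: xeU; rewrite (splitr e).
  by split; [exact: ball_triangle (le_ball (ltW ne) xp) (le_ball (ltW ne) py)|
    exact: ball_triangle (le_ball (ltW ne) xq) (le_ball (ltW ne) qy)].
apply: bigcupT_measurable_rat => p; apply: bigcupT_measurable_rat => q.
apply: bigcupT_measurable => n; rewrite /F; case: asboolP => // _.
rewrite (_ : B p q n = ball (ratr p : R) n.+1%:R^-1 `*` ball (ratr q : R) n.+1%:R^-1)//.
by apply: measurableX; exact: measurable_ball.
Qed.

Lemma continuous_measurable_plane (f : R * R -> R) : continuous f -> measurable_fun setT f.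
Proof.
move=> /continuousP cf; apply: (measurability _ (RGenOInfty.measurableE R)) => //.
move=> _ [_ [a ->] <-]; rewrite setTI; apply: open_measurable_plane; apply: cf.
exact: itv_open_ends_open.
Qed.

End continuous_measurable_plane.

(** * Continuous densities of isotropic measures *)

Section density.
Context {R : realType}.
Notation mu := (@lebesgue_measure R).
Notation mu2 := (mu \x mu)%E.
Implicit Types (x c : (R * R)%type) (S : set (R * R)) (b r t : R).
Variables (L : set (R * R) -> \bar R) (lam : R * R -> R).
Hypotheses (L_ge0 : forall S, (0 <= L S)%E) (L_density : has_density L lam)
  (lam_continuous : continuous lam).

(** The sign of [lam] is not known at this stage, so monotonicity of the integral is applied to
    integrable functions; bounds on a set of finite area give integrability. *)
Lemma density_bounds S b1 b2 : measurable S -> (mu2 S < +oo)%E ->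
  (forall x, S x -> b1 <= lam x <= b2) ->
  (b1%:E * mu2 S <= L S <= b2%:E * mu2 S)%E.
Proof.
move=> mS Sfin Sb; rewrite L_density//.
have mlam := continuous_measurable_plane lam_continuous.
have ilam : mu2.-integrable S (EFin \o lam).
  apply: measurable_bounded_integrable => //.
    exact: measurable_funTS.
  exists (Num.max `|b1| `|b2|); split; first exact: num_real.
  move=> M bM x Sx; have /andP[h1 h2] := Sb x Sx.
  apply: ltW; apply: le_lt_trans bM; rewrite le_max.
  have [l0|l0] := lerP 0 (lam x).
    by rewrite ger0_norm// (le_trans h2 (ler_norm _)) orbT.
  by rewrite ltr0_norm// -(normrN b1) (@le_trans _ _ (- b1)) ?ler_norm ?lerN2.
have icst b : mu2.-integrable S (EFin \o cst b).
  apply: measurable_bounded_integrable => //.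
  exists `|b|; split; first exact: num_real.
  by move=> M bM x Sx /=; exact: ltW.
rewrite -!integral_cst//; apply/andP; split; apply: le_integral => //.
- exact: icst.
- by move=> x /[!inE] /Sb/andP[? ?]; rewrite lee_fin.
- exact: icst.
- by move=> x /[!inE] /Sb/andP[? ?]; rewrite lee_fin.
Qed.

(** By continuity [lam] stays within [e] of [lam c] near [c]. This recovers pointwise values from
    masses and yields the sign of [lam], its rotation invariance and a quadratic bound on small
    centred discs. *)
Lemma density_local c (e : R) : 0 < e -> exists2 r0 : R, 0 < r0 & forall r, 0 <= r <= r0 ->
  (((lam c - e) * (pi * r ^+ 2))%:E <= L [set x | enorm (x - c) <= r]%R
    <= ((lam c + e) * (pi * r ^+ 2))%:E)%E.
Proof.
move=> e0; have /cvgrPdist_lt/(_ e e0) := @lam_continuous c.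
move=> /nbhs_ballP[r1 /= r10 H]; exists (r1 / 2); first by rewrite divr_gt0.
move=> r /andP[r0 rr].
rewrite !(EFinM _ (pi * r ^+ 2)) -(lebesgue2_disc_at c r0); apply: density_bounds.
- exact: measurable_disc_at.
- by rewrite lebesgue2_disc_at// ltry.
move=> x xr; have : ball c r1 x.
  rewrite -ball_normE/= distrC (le_lt_trans (norm_le_enorm _))//.
  by apply: le_lt_trans xr _; lra.
by move=> /H; rewrite ltr_norml => /andP[h1 h2]; apply/andP; split; lra.
Qed.

Lemma density_ge0 x : 0 <= lam x.
Proof.
rewrite leNgt; apply/negP => x0.
(* With this tolerance the upper bound is lam x / 2 times a positive area, which is negative. *)
have [|r r0] := @density_local x (- lam x / 2); first by lra.
move=> /(_ r); rewrite lexx ltW// => /(_ isT)/andP[_].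
apply/negP; rewrite -ltNge; apply: lt_le_trans (L_ge0 _).
rewrite lte_fin; have -> : lam x + - lam x / 2 = lam x / 2 by field.
by rewrite pmulr_llt0 ?mulr_gt0 ?pi_gt0 ?exprn_gt0//; lra.
Qed.

Hypothesis L_isotropic : isotropic L.

(* [rotation t] maps the disc of radius [r] around [x] onto the one around
   [rotation t x], which has the same area. *)
Let density_le_rotation x t : lam x <= lam (rotation t x).
Proof.
apply/ler_addgt0Pr => e e0.
have e2 : 0 < e / 2 by rewrite divr_gt0.
have [r1 r10 H1] := density_local x e2.
have [r2 r20 H2] := density_local (rotation t x) e2.
pose r := Num.min r1 r2.
have r0 : 0 < r by rewrite lt_min r10.
have := H1 r; have := H2 r; rewrite ge_min lexx ltW// ge_min lexx orbT.
move=> /(_ isT)/andP[_ h2] /(_ isT)/andP[h1 _].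
have : (lam x - e / 2) * (pi * r ^+ 2) <= (lam (rotation t x) + e / 2) * (pi * r ^+ 2).
  rewrite -lee_fin; apply: le_trans h1 _; apply: le_trans h2.
  rewrite (L_isotropic t) ?rotation_image; last exact: measurable_disc_at.
  rewrite [X in (L X <= _)%E](_ : _ = [set y | enorm (y - rotation t x) <= r])//.
  apply/seteqP; split => y /=;
    by rewrite -(enorm_rotation t (rotation (- t) y - x)) rotationB rotationD addrN rotation0.
rewrite -subr_ge0 -mulrBl pmulr_lge0 ?mulr_gt0 ?pi_gt0 ?exprn_gt0//; lra.
Qed.

Lemma density_rotation x t : lam (rotation t x) = lam x.
Proof.
apply/eqP; rewrite eq_le density_le_rotation andbT.
by rewrite (le_trans (density_le_rotation _ (- t)))// rotationD addNr rotation0.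
Qed.

Lemma density_radial x : lam x = radial lam (enorm x).
Proof.
have [a _ [E|E]] := polar_angle x; rewrite /radial.
  rewrite -(density_rotation (enorm x, 0) a) {1}E; congr lam.
  by rewrite /rotation/=; congr (_, _); ring.
(* The opposite sign in [polar_angle] amounts to a further half-turn. *)
rewrite -(density_rotation (enorm x, 0) (a + pi)) {1}E; congr lam.
by rewrite /rotation/= cosDpi sinDpi; congr (_, _); ring.
Qed.

End density.

Lemma measureD_fine d (T : measurableType d) (R : realType)
    (m : {measure set T -> \bar R}) (A B : set T) (a b : R) :
  measurable A -> measurable B -> A `<=` B -> m A = a%:E -> m B = b%:E ->
  m (B `\` A) = (b - a)%:E.
Proof.
move=> mA mB AB ma mb; have mBoo : (m B < +oo)%E by rewrite mb ltry.
by rewrite (measureD mB mA mBoo) (setIidr AB) EFinB -ma -mb.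
Qed.

(** * Derivative of the mass of centred discs *)

Section radial_density.
Context {R : realType}.
Notation mu := (@lebesgue_measure R).
Notation mu2 := (mu \x mu)%E.
Implicit Types (x c : (R * R)%type) (S : set (R * R)) (a b r t : R).
Variables (L : {measure set (R * R) -> \bar R}) (lam : R * R -> R).
Hypotheses (L_density : has_density L lam) (lam_continuous : continuous lam)
  (L_fin : forall r, L (disc r) \is a fin_num) (L_isotropic : isotropic L).

Let M r := fine (L (disc r)).

Lemma continuous_radial : continuous (radial lam).
Proof.
move=> r.
have c : (s, 0 : R) @[s --> r] --> (r, 0 : R).
  by apply: (@cvg_pair _ _ _ (nbhs r) (nbhs r) (nbhs (0 : R))) => //; exact: cvg_cst.
have := cvg_comp _ _ c (@lam_continuous (r, 0)). exact.
Qed.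

Lemma annulus_bounds a b b1 b2 : 0 <= a <= b ->
  (forall r, a <= r <= b -> b1 <= radial lam r <= b2) ->
  b1 * (pi * (b ^+ 2 - a ^+ 2)) <= M b - M a <= b2 * (pi * (b ^+ 2 - a ^+ 2)).
Proof.
move=> /andP[a0 ab] H.
have sab : disc a `<=` (disc b : set (R * R)) by move=> x xa; exact: le_trans xa ab.
have mub : mu2 (disc b) = (pi * b ^+ 2)%:E by rewrite lebesgue2_disc// (le_trans a0).
have mua : mu2 (disc a) = (pi * a ^+ 2)%:E by rewrite lebesgue2_disc.
have muE : mu2 (disc b `\` disc a) = (pi * (b ^+ 2 - a ^+ 2))%:E.
  by rewrite mulrBr; apply: measureD_fine mua mub => //; exact: measurable_disc.
have := @density_bounds _ L lam L_density lam_continuous (disc b `\` disc a) b1 b2.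
rewrite muE (@measureD_fine _ _ _ _ _ _ (M a) (M b)) ?fineK//; [|exact: measurable_disc..].
rewrite -!EFinM !lee_fin; apply.
- by apply: measurableD; exact: measurable_disc.
- exact: ltry.
- move=> x [xb /negP]; rewrite -ltNge => xa.
  rewrite (density_radial L_density lam_continuous L_isotropic).
  by apply: H; rewrite ltW.
Qed.

(** The difference quotient is the product of the mass per unit area of a thin annulus, which tends
    to [radial lam r], and its area per unit width, pi (2 r + t). *)
Lemma is_derive_radial r : 0 < r -> is_derive r 1 M (2 * pi * (radial lam r * r)).
Proof.
move=> r0; have pi0 := @pi_gt0 R.
suff H : (fun t => t^-1 *: (M (t *: 1 + r) - M r)) @ 0^' --> 2 * pi * (radial lam r * r).
  by split; [exact: cvgP H|exact: cvg_lim H].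
have xi : (fun t => (M (t + r) - M r) / (pi * ((t + r) ^+ 2 - r ^+ 2))) @ 0^' --> radial lam r.
  (* by annulus_bounds the quotient lies between the extrema of [radial lam] *)
  apply/cvgrPdist_le => e e0.
  have /cvgrPdist_le/(_ e e0)/nbhs_ballP[k /= k0 Hk] := @continuous_radial r.
  near=> t.
  have t0 : t != 0 by near: t; exact: nbhs_dnbhs_neq.
  (* The bound by [r] keeps both radii of the annulus positive; the bound by [k] keeps them in the
     ball given by continuity. *)
  have tr : `|t| < Num.min r k.
    near: t; apply: dnbhs0_lt; by rewrite lt_min r0.
  move: tr; rewrite lt_min => /andP[tr tk].
  have Hb a b : r - k < a -> b < r + k -> forall s, a <= s <= b ->
      radial lam r - e <= radial lam s <= radial lam r + e.
    move=> ak bk s /andP[as_ sb].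
    have : ball r k s by rewrite -ball_normE/= ltr_distl; apply/andP; split; lra.
    by move=> /Hk; rewrite ler_distl => /andP[h1 h2]; apply/andP; split; lra.
  (* For negative [t] the outer radius is [r], so numerator and denominator both change sign. *)
  have [tn|tp|tz] := ltgtP t 0; last by rewrite tz eqxx in t0.
    have tr' : - t < r by rewrite -(ltr0_norm tn).
    have tk' : - t < k by rewrite -(ltr0_norm tn).
    have := @annulus_bounds (t + r) r (radial lam r - e) (radial lam r + e).
    have h1 : 0 <= t + r <= r by apply/andP; split; lra.
    move=> /(_ h1 (Hb _ _ _ _))/andP[||A B]; [lra|lra|].
    have D : 0 < pi * (r ^+ 2 - (t + r) ^+ 2) by rewrite mulr_gt0//; nra.
    rewrite -(opprB (M r)) -(opprB (r ^+ 2)) mulrN invrN mulrNN ler_distlC.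
    by rewrite ler_pdivrMr// ler_pdivlMr// A B.
  have tr' : t < r by rewrite -(gtr0_norm tp).
  have tk' : t < k by rewrite -(gtr0_norm tp).
  have := @annulus_bounds r (t + r) (radial lam r - e) (radial lam r + e).
  have h1 : 0 <= r <= t + r by apply/andP; split; lra.
  move=> /(_ h1 (Hb _ _ _ _))/andP[||A B]; [lra|lra|].
  have D : 0 < pi * ((t + r) ^+ 2 - r ^+ 2) by rewrite mulr_gt0//; nra.
  rewrite ler_distlC.
  by rewrite ler_pdivrMr// ler_pdivlMr// A B.
have c2 : (fun t => pi * (t + r + r)) @ 0^' --> pi * (0 + r + r).
  apply: cvgMr; apply: cvgD; last exact: cvg_cst.
  apply: cvgD; last exact: cvg_cst.
  exact: cvg_within.
have := cvgM xi c2.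
rewrite (_ : radial lam r * (pi * (0 + r + r)) = 2 * pi * (radial lam r * r)); last by ring.
move=> cc; apply: (cvg_trans _ (cc _)); apply: near_eq_cvg; near=> t => /=.
have t0 : t != 0 by near: t; exact: nbhs_dnbhs_neq.
have tr : `|t| < r by near: t; exact: dnbhs0_lt.
have : t + r + r != 0.
  rewrite gt_eqF//; move: tr; rewrite ltr_norml => /andP[h _]; lra.
rewrite /GRing.scale/= mulr1 => trr.
have -> : (t + r) ^+ 2 - r ^+ 2 = t * (t + r + r) by ring.
by move: (pi : R) pi0 => p p0; field; rewrite t0 trr gt_eqF.
Unshelve. all: by end_near. Qed.

End radial_density.

(** * Continuity of the disc mass and its integral formula *)

Section disc_mass.
Context {R : realType}.
Notation mu := (@lebesgue_measure R).
Implicit Types (a b r t : R).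
Variables (L : {measure set (R * R) -> \bar R}) (lam : R * R -> R).
Hypotheses (L_density : has_density L lam) (lam_continuous : continuous lam)
  (L_fin : forall r, L (disc r) \is a fin_num) (L_isotropic : isotropic L).

Let M r := fine (L (disc r)).

Lemma disc_lt0 r : r < 0 -> disc r = set0 :> set (R * R).
Proof.
move=> r0; apply/seteqP; split => x //.
by rewrite /disc/= leNgt (lt_le_trans r0 (enorm_ge0 x)).
Qed.

Lemma disc_mass_ge0 r : 0 <= M r.
Proof. exact: fine_ge0. Qed.

(** The constant comes from [density_local] at the origin with tolerance 1. The bound excludes an
    atom there and gives continuity of the mass at radius 0, where the annulus argument does not
    apply. *)
Lemma disc_mass_small : exists2 r0 : R, 0 < r0 & exists2 K : R, 0 <= K &
  forall r, r <= r0 -> M r <= K * r ^+ 2.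
Proof.
have [r0 r00 H] := density_local L_density lam_continuous 0 (@ltr01 R).
have l0 := density_ge0 (measure_ge0 L) L_density lam_continuous 0.
have pi0 := @pi_gt0 R.
have K0 : 0 <= (lam 0 + 1) * pi by apply: mulr_ge0; lra.
exists r0 => //; exists ((lam 0 + 1) * pi) => // r rr0.
have [rn|rp] := ltP r 0.
  by rewrite /M disc_lt0// measure0/= mulr_ge0 ?sqr_ge0.
have := H r; rewrite rp rr0 => /(_ isT)/andP[_].
rewrite (_ : [set x | _] = disc r); last by apply/seteqP; split => x; rewrite /disc/= subr0.
by rewrite -(fineK (L_fin r)) lee_fin mulrA.
Qed.

Lemma disc_mass_le0 r : r <= 0 -> M r = 0.
Proof.
have [r0 r00 [K K0 H]] := disc_mass_small.
have M0 : M 0 = 0.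
  have := H 0 (ltW r00); rewrite expr0n/= mulr0 => h.
  by apply/eqP; rewrite eq_le h disc_mass_ge0.
rewrite le_eqVlt => /predU1P[->//|rn].
by rewrite /M disc_lt0// measure0.
Qed.

Lemma continuous_disc_mass : continuous M.
Proof.
move=> r; have [r0|rn|<-] := ltgtP 0 r.
- have [dM _] := is_derive_radial L_density lam_continuous L_fin L_isotropic r0.
  exact/differentiable_continuous/derivable1_diffP.
- rewrite /continuous_at (disc_mass_le0 (ltW rn)).
  apply: cvg_near_cst; near=> s.
  by rewrite disc_mass_le0//; near: s; exact: lt_le_nbhsl.
- rewrite /continuous_at disc_mass_le0//.
  have [r1 r10 [K K0 H]] := disc_mass_small.
  apply: (@squeeze_cvgr _ _ _ _ (fun=> 0) (fun s => K * s ^+ 2)).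
  + near=> s; rewrite disc_mass_ge0/= H//.
    near: s; exact: lt_le_nbhsl.
  + exact: cvg_cst.
  + have e : K * 0 ^+ 2 = 0 :> R by rewrite expr0n mulr0.
    rewrite -[X in _ --> X]e; apply: cvgMr; exact: exprn_continuous.
Unshelve. all: by end_near. Qed.

Lemma continuous_radial_mass : continuous (fun r => radial lam r * r).
Proof. by move=> r; apply: cvgM; [exact: continuous_radial|exact: cvg_id]. Qed.

(** The derivative of [M] divided by [2 * pi] is the integrand at positive radii, and continuity at
    0 covers the endpoint. This identifies the inner integral of the density formula with a disc
    mass. *)
Lemma integral_radial r : 0 <= r ->
  \int[mu]_(s in `[0, r]) (radial lam s * s) = M r / (2 * pi).
Proof.
have pi0 := @pi_gt0 R.
rewrite le_eqVlt => /predU1P[<-|r0].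
  by rewrite set_itv1 Rintegral_set1 disc_mass_le0// mul0r.
have cM : continuous (fun r => M r / (2 * pi)).
  by move=> s; apply: cvgMl; exact: continuous_disc_mass.
have dM s : 0 < s < r -> is_derive s 1 (fun r => M r / (2 * pi)) (radial lam s * s).
  move=> /andP[s0 _].
  have := is_derive_radial L_density lam_continuous L_fin L_isotropic s0 => dM.
  apply: is_derive_eq; rewrite scaler0 add0r /GRing.scale/=.
  by move: (pi : R) pi0 => p p0; field; rewrite gt_eqF.
have cm := @continuous_subspaceT _ _ `[0, r]%classic _ continuous_radial_mass.
rewrite /Rintegral (FTC2_is_derive r0 cm (cvg_at_right_filter (cM 0))
  (cvg_at_left_filter (cM r)) dM).
by rewrite (disc_mass_le0 (lexx 0)) mul0r subr0.
Qed.

End disc_mass.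

(** * Integrals depending on a parameter *)

Section bounded_itv.
Context {R : realType}.
Notation mu := (@lebesgue_measure R).
Implicit Types (a b : R).

Lemma bounded_itv_integrable a b (f : R -> R) (C : R) : measurable_fun setT f ->
  (forall t, a <= t <= b -> `|f t| <= C) -> mu.-integrable `[a, b] (EFin \o f).
Proof.
move=> mf fC; apply: measurable_bounded_integrable => //.
- rewrite [X in (X < _)%E]lebesgue_measure_itv/=; case: ifPn => _; last by rewrite ltry.
  by rewrite -EFinB ltry.
- exact: measurable_funTS.
- exists C; split; first exact: num_real.
  move=> M CM t /=; rewrite in_itv/= => /fC h.
  by rewrite (le_trans h)// ltW.
Qed.

(** Dominated convergence. Continuity is not asked at [t = b], since the kernel has a vanishing
    denominator at [g = d], [t = pi / 2]. The bound depends only on an upper bound [V] for [g],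
    which suits integrands truncated below at [d]. *)
Lemma continuous_param_integral a b (f : R -> R -> R) :
  (forall g, measurable_fun setT (f g)) ->
  (forall t, a <= t < b -> continuous (f ^~ t)) ->
  (forall V, exists C, forall g t, g <= V -> a <= t <= b -> `|f g t| <= C) ->
  continuous (fun g => \int[mu]_(t in `[a, b]) f g t).
Proof.
move=> mf cf bf g.
have [C HC] := bf (g + 1).
have h : g \in (`]g - 1, g + 1[%classic : set R).
  by rewrite inE/= in_itv/=; apply/andP; split; lra.
apply: (@continuity_under_integral R _ _ mu f `[a, b]%classic _
  (g - 1) (g + 1) _ _ (fun=> C)) => //.
- move=> x; rewrite /= in_itv/= => /andP[_ xg].
  apply: (@bounded_itv_integrable a b (f x) C) => // t; apply: HC; exact: ltW.
- exists [set b]; split; [exact: measurable_set1|exact: lebesgue_measure_set1|].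
  move=> t /=; apply: contra_notP => tb.
  rewrite in_itv/= => /andP[at_ tb'] x _; apply: cf.
  by rewrite at_/= lt_neqAle tb' andbT; apply/eqP.
- apply: (@bounded_itv_integrable a b (fun=> C) `|C|) => //.
- move=> x; rewrite /= in_itv/= => /andP[_ xg]; apply: aeW => t.
  by rewrite in_itv/= => tI; apply: HC => //; exact: ltW.
Qed.

Lemma is_derive_param_integral a b u v g (f df : R -> R -> R) (C : R) :
  u < g < v -> 0 <= C ->
  (forall x, u < x < v -> mu.-integrable `[a, b] (EFin \o f x)) ->
  (forall x t, u < x < v -> a <= t <= b -> is_derive x 1 (f ^~ t) (df x t)) ->
  (forall x t, u < x < v -> a <= t <= b -> `|df x t| <= C) ->
  is_derive g 1 (fun x => \int[mu]_(t in `[a, b]) f x t)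
    (\int[mu]_(t in `[a, b]) df g t).
Proof.
move=> guv C0 intf derf bdf.
have h : (`]u, v[%classic : set R) g by rewrite /= in_itv.
have intC : mu.-integrable `[a, b] (EFin \o (fun=> C)).
  exact: (@bounded_itv_integrable a b (fun=> C) `|C|).
have if1 x : `]u, v[%classic x -> mu.-integrable `[a, b]%classic (EFin \o f x).
  by rewrite /= in_itv; exact: intf.
have df1 x t : `]u, v[%classic x -> `[a, b]%classic t -> derivable (f^~ t) x 1.
  by rewrite /= !in_itv/= => xI tI; have [] := derf x t xI tI.
have pE x t : `]u, v[%classic x -> `[a, b]%classic t -> partial1of2 f x t = df x t.
  by rewrite /= !in_itv/= => xI tI; rewrite partial1of2E; have [_] := derf x t xI tI.
have bf1 x t : `]u, v[%classic x -> `[a, b]%classic t -> `|partial1of2 f x t| <= C.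
  by move=> xI tI; rewrite pE//; apply: bdf; [move: xI|move: tI]; rewrite /= in_itv.
have mB : measurable (`[a, b]%classic : set R) by [].
have H1 := @derivable_under_integral R _ _ mu f _ mB g u v h if1 df1 _ (fun=> C0) intC bf1.
have H2 := @differentiation_under_integral R _ _ mu f _ mB g u v h if1 df1 _ (fun=> C0) intC bf1.
split; first exact: H1.
rewrite -derive1E; apply: etrans H2 _.
by apply: eq_Rintegral => t; rewrite inE => tI; exact: pE.
Qed.

End bounded_itv.

(** * Regularity of the polar radius in gamma *)

Section polar_radius.
Context {R : realType}.
Implicit Types (d g t : R).

Lemma cos_ge0_quadrant t : 0 <= t <= pi / 2 -> 0 <= cos t.
Proof.
have pi0 := @pi_gt0 R.
by move=> /andP[t0 tp]; apply: cos_ge0_pihalf; rewrite tp andbT; lra.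
Qed.

Lemma polar_radicand d g t :
  g ^+ 2 - d ^+ 2 * sin t ^+ 2 = g ^+ 2 - d ^+ 2 + (d * cos t) ^+ 2.
Proof. by rewrite sin2cos2; ring. Qed.

(** The radicand is g^2 - d^2 + (d cos t)^2, a sum of two nonnegative terms that vanish together
    only if [g = d] and [cos t = 0]. *)
Lemma polar_radicand_gt0 d g t : 0 < d -> d <= g -> 0 < cos t \/ d < g ->
  0 < g ^+ 2 - d ^+ 2 * sin t ^+ 2.
Proof.
move=> d0 dg H; rewrite polar_radicand.
have h1 : 0 <= g ^+ 2 - d ^+ 2 by nra.
case: H => [c0|dg']; first by rewrite ltr_wpDl// exprn_gt0// mulr_gt0.
by rewrite ltr_pwDl ?sqr_ge0//; nra.
Qed.

Lemma polar_radius_gt0 d g t : 0 < d -> d < g -> 0 < polar_radius d g t.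
Proof.
move=> d0 dg; rewrite subr_gt0 polar_radicand.
apply: le_lt_trans (ler_norm _) _; rewrite -sqrtr_sqr ltr_sqrt.
  by rewrite ltrDr; nra.
by rewrite ltr_pwDl ?sqr_ge0//; nra.
Qed.

Lemma le_polar_radius_sqrt d g t : 0 < d -> 0 <= cos t ->
  polar_radius d g t <= Num.sqrt (g ^+ 2 - d ^+ 2 * sin t ^+ 2).
Proof. by move=> d0 c0; rewrite gerBl mulr_ge0// ltW. Qed.

Lemma polar_radius_le d g t : 0 < d -> 0 <= g -> 0 <= cos t ->
  polar_radius d g t <= g.
Proof.
move=> d0 g0 c0; apply: le_trans (le_polar_radius_sqrt _ _ _) _ => //.
by rewrite -[leRHS]ger0_norm// -sqrtr_sqr ler_wsqrtr// gerBl mulr_ge0 ?sqr_ge0.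
Qed.

(** This keeps the kernel bounded up to the corner where the square root vanishes; there the
    quotient is 0 by convention. *)
Lemma polar_ratio d g t : 0 < d -> d <= g -> 0 <= cos t ->
  0 <= polar_radius d g t / Num.sqrt (g ^+ 2 - d ^+ 2 * sin t ^+ 2) <= 1.
Proof.
move=> d0 dg c0; rewrite divr_ge0 ?sqrtr_ge0 ?polar_radius_ge0//=.
have := sqrtr_ge0 (g ^+ 2 - d ^+ 2 * sin t ^+ 2).
rewrite le_eqVlt => /predU1P[<-|s0]; first by rewrite invr0 mulr0.
by rewrite ler_pdivrMr// mul1r le_polar_radius_sqrt.
Qed.

Lemma continuous_polar_sqrt d t :
  continuous (fun g => Num.sqrt (g ^+ 2 - d ^+ 2 * sin t ^+ 2)).
Proof.
move=> g; apply: (@cvg_comp _ _ _ (fun g => g ^+ 2 - d ^+ 2 * sin t ^+ 2) Num.sqrt).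
  by apply: cvgB; [exact: exprn_continuous|exact: cvg_cst].
exact: sqrt_continuous.
Qed.

Lemma continuous_polar_radius d t : continuous (polar_radius d ^~ t).
Proof. by move=> g; apply: cvgB; [exact: continuous_polar_sqrt|exact: cvg_cst]. Qed.

Lemma is_derive_polar_radius d g t : 0 < d -> d < g ->
  is_derive g 1 (polar_radius d ^~ t) (g / Num.sqrt (g ^+ 2 - d ^+ 2 * sin t ^+ 2)).
Proof.
move=> d0 dg.
have e0 : 0 < g ^+ 2 - d ^+ 2 * sin t ^+ 2 by apply: polar_radicand_gt0 => //; [exact: ltW|right].
have D1 : is_derive g 1 (fun g => g ^+ 2 - d ^+ 2 * sin t ^+ 2) (2 * g).
  by apply: is_derive_eq; rewrite /GRing.scale/=; ring.
have D2 := @is_derive1_comp R Num.sqrt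
  (fun g => g ^+ 2 - d ^+ 2 * sin t ^+ 2) g _ _ (is_derive1_sqrt e0) D1.
rewrite /polar_radius; apply: is_derive_eq.
rewrite subr0; field; by rewrite gt_eqF ?sqrtr_gt0.
Qed.

Lemma measurable_polar_kernel d g (h : R -> R) : measurable_fun setT h ->
  measurable_fun setT (fun t => g * polar_radius d g t /
    Num.sqrt (g ^+ 2 - d ^+ 2 * sin t ^+ 2) * h (polar_radius d g t)).
Proof.
move=> mh; have mr := measurable_polar_radius d g.
apply: measurable_funM; last exact: measurableT_comp.
apply: measurable_funM; first exact: measurable_funM.
(* The inverse is discontinuous at 0; as a real power with exponent -1 it is measurable
   everywhere. *)
under eq_fun do rewrite -powR_inv1 ?sqrtr_ge0//.
apply: (@measurableT_comp _ _ _ _ _ _ (fun x => x `^ (-1))); first exact: measurable_powR.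
apply: measurableT_comp measurable_sqrt _.
apply: measurable_funB => //; apply: measurable_funM => //.
by apply: measurable_funX; exact: measurable_sin.
Qed.

Lemma continuous_maxl d : continuous (fun g => Num.max g d).
Proof. by move=> g; apply: (@continuous_max _ _ id (cst d)); [exact: cvg_id|exact: cvg_cst]. Qed.

Lemma continuous_polar_kernel d t (h : R -> R) : 0 < d -> 0 < cos t -> continuous h ->
  continuous (fun g => Num.max g d * polar_radius d (Num.max g d) t /
    Num.sqrt (Num.max g d ^+ 2 - d ^+ 2 * sin t ^+ 2) *
    h (polar_radius d (Num.max g d) t)).
Proof.
move=> d0 c0 ch g.
have cm := @continuous_maxl d g.
apply: (@cvg_comp _ _ _ (fun g => Num.max g d) (fun g => g * polar_radius d g t /
    Num.sqrt (g ^+ 2 - d ^+ 2 * sin t ^+ 2) * h (polar_radius d g t)) _ _ _ cm).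
have cr := @continuous_polar_radius d t (Num.max g d).
apply: cvgM; last exact: cvg_comp cr (ch _).
apply: cvgM; first by apply: cvgM => //; exact: cvg_id.
apply: cvgV; last exact: continuous_polar_sqrt.
rewrite gt_eqF// sqrtr_gt0; apply: polar_radicand_gt0 => //.
  by rewrite le_max lexx orbT.
by left.
Qed.

End polar_radius.

Section polar_mass.
Context {R : realType}.
Notation mu := (@lebesgue_measure R).
Implicit Types (a b r t g : R).
Variables (L : {measure set (R * R) -> \bar R}) (lam : R * R -> R) (d : R).
Hypotheses (L_density : has_density L lam) (lam_continuous : continuous lam)
  (L_fin : forall r, L (disc r) \is a fin_num) (L_isotropic : isotropic L)
  (d_gt0 : 0 < d).

Let M r := fine (L (disc r)).
Let kernel g t := g * polar_radius d g t /
  Num.sqrt (g ^+ 2 - d ^+ 2 * sin t ^+ 2) * radial lam (polar_radius d g t).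

Lemma radial_ge0 r : 0 <= radial lam r.
Proof. exact: density_ge0 (measure_ge0 L) L_density lam_continuous _. Qed.

Lemma radial_bounded (V : R) :
  exists2 C : R, 0 <= C & forall r, 0 <= r <= V -> radial lam r <= C.
Proof.
have [V0|V0] := ltP V 0.
  by exists 0 => // r /andP[r0 rV]; have := le_lt_trans (le_trans r0 rV) V0; rewrite ltxx.
have [c _ H] := EVT_max V0 (@continuous_subspaceT _ _ `[0, V]%classic _
  (continuous_radial lam_continuous)).
by exists (radial lam c); [exact: radial_ge0|move=> r rV; apply: H; rewrite in_itv].
Qed.

(** The kernel is [g] times the ratio of [polar_ratio] times a value of [radial lam] at a radius
    between 0 and [V]; each factor is bounded separately. *)
Lemma kernel_bounded V : exists2 C : R, 0 <= C & forall g t, d <= g -> g <= V ->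
  0 <= t <= pi / 2 -> 0 <= kernel g t <= C.
Proof.
have [C C0 HC] := radial_bounded V.
have dd : 0 <= d by exact: ltW.
exists (Num.max V 0 * C); first by rewrite mulr_ge0// le_max lexx orbT.
move=> g t dg gV tI; have c0 := cos_ge0_quadrant tI.
have g0 : 0 <= g by exact: le_trans dg.
have /andP[q0 q1] := polar_ratio d_gt0 dg c0.
have r0 := radial_ge0 (polar_radius d g t).
rewrite /kernel -[X in X * _]mulrA -mulrA.
have rC : radial lam (polar_radius d g t) <= C.
  by apply: HC; rewrite polar_radius_ge0//= (le_trans (polar_radius_le _ _ _)).
apply/andP; split; first by rewrite mulr_ge0// mulr_ge0.
apply: ler_pM => //; [by rewrite mulr_ge0|by rewrite le_max gV|].
by rewrite -[leRHS]mul1r; apply: ler_pM.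
Qed.

Lemma measurable_kernel g : measurable_fun setT (kernel g).
Proof.
apply: measurable_polar_kernel.
exact: continuous_measurable_fun (continuous_radial lam_continuous).
Qed.

Lemma continuous_kernel_integral :
  continuous (fun g => \int[mu]_(t in `[0, pi / 2]) kernel (Num.max g d) t).
Proof.
have pi0 := @pi_gt0 R.
apply: continuous_param_integral => [g|t /andP[t0 tp]|V].
- exact: measurable_kernel.
- apply: continuous_polar_kernel => //.
    by apply: cos_gt0_pihalf; rewrite tp andbT; lra.
  exact: continuous_radial.
- have [C C0 HC] := kernel_bounded (Num.max V d).
  exists C => g t gV tI.
  have /andP[h1 h2] : 0 <= kernel (Num.max g d) t <= C.
    apply: HC => //; first by rewrite le_max lexx orbT.
    by rewrite ge_max !le_max gV lexx orbT.
  by rewrite ger0_norm.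
Qed.

Lemma disc_mass_bounded V : forall g t, d <= g -> g <= V -> 0 <= t <= pi / 2 ->
  `|M (polar_radius d g t)| <= M V.
Proof.
move=> g t dg gV tI; rewrite ger0_norm ?disc_mass_ge0//.
apply: le_disc_mass => //; apply: le_trans gV; apply: polar_radius_le => //.
- by rewrite (le_trans _ dg)// ltW.
- exact: cos_ge0_quadrant.
Qed.

Lemma continuous_mass_integral :
  continuous (fun g => \int[mu]_(t in `[0, pi / 2]) M (polar_radius d (Num.max g d) t)).
Proof.
apply: continuous_param_integral => [g|t _|V].
- exact: measurable_disc_mass.
- move=> g; have c1 := cvg_comp _ _ (@continuous_maxl R d g)
    (@continuous_polar_radius R d t (Num.max g d)).
  exact: cvg_comp _ _ c1 (@continuous_disc_mass _ _ _ L_density lam_continuous L_fin L_isotropic _).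
- exists (M (Num.max V d)) => g t gV tI.
  apply: disc_mass_bounded => //; first by rewrite le_max lexx orbT.
  by rewrite ge_max !le_max gV lexx orbT.
Qed.

(** The chain rule combines M'(r) = 2 pi r lam(r) with the derivative of the polar radius, and
    [kernel_bounded] dominates on []d, g + 1[]. At [g = d] the polar radius is not differentiable
    for [t = pi / 2]. *)
Lemma is_derive_mass_integral g : d < g ->
  is_derive g 1 (fun g => \int[mu]_(t in `[0, pi / 2]) M (polar_radius d g t))
    (2 * pi * \int[mu]_(t in `[0, pi / 2]) kernel g t).
Proof.
move=> dg; have [C C0 HC] := kernel_bounded (g + 1).
have pi0 := @pi_gt0 R.
have p20 : 0 <= 2 * pi :> R by lra.
rewrite -RintegralZl//; last first.
  apply: (@bounded_itv_integrable _ _ _ _ C); first exact: measurable_kernel.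
  move=> t tI; have /andP[h1 h2] : 0 <= kernel g t <= C by apply: HC => //; lra.
  by rewrite ger0_norm.
apply: (@is_derive_param_integral _ _ _ d (g + 1) g
  (fun g t => M (polar_radius d g t)) (fun g t => 2 * pi * kernel g t) (2 * pi * C)).
- by rewrite dg/=; lra.
- by rewrite mulr_ge0.
- move=> x /andP[dx xg]; apply: (@bounded_itv_integrable _ _ _ _ (M (g + 1))).
    exact: measurable_disc_mass.
  by move=> t tI; apply: disc_mass_bounded => //; exact: ltW.
- move=> x t /andP[dx xg] tI.
  have r0 := polar_radius_gt0 t d_gt0 dx.
  have D1 := is_derive_radial L_density lam_continuous L_fin L_isotropic r0.
  have D2 := is_derive_polar_radius t d_gt0 dx.
  have := @is_derive1_comp R M (polar_radius d ^~ t) x _ _ D1 D2.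
  by congr is_derive; rewrite /kernel; ring.
- move=> x t /andP[dx xg] tI.
  have /andP[h1 h2] : 0 <= kernel x t <= C by apply: HC => //; exact: ltW.
  have k0 : 0 <= 2 * pi * kernel x t by rewrite mulr_ge0.
  by rewrite (ger0_norm k0); apply: ler_wpM2l.
Qed.

End polar_mass.

(** * From distribution function to density *)

Section pdf_of_cdf.
Local Open Scope ereal_scope.
Context {disp : measure_display} {Omega : measurableType disp} {R : realType}.
Variables (P : probability Omega R) (X : {RV P >-> \bar R}).
Notation mu := (@lebesgue_measure R).

(** Finiteness allows subtracting half-lines, so the measures agree on half-open intervals, which
    are stable under intersection, generate the Borel sets and exhaust the line. *)
Lemma finite_measure_eq_ocitv (m1 m2 : {measure set (measurableTypeR R) -> \bar R}) :
  (forall r, m1 `]-oo, r]%classic = m2 `]-oo, r]%classic) ->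
  (forall r, m1 `]-oo, r]%classic < +oo) ->
  forall A, measurable A -> m1 A = m2 A.
Proof.
move=> m12 m1oo.
have mE a b : m1 `]a, b]%classic = m2 `]a, b]%classic.
  have [ab|ba] := leP a b; last first.
    by rewrite set_itv_ge ?measure0// bnd_simp -leNgt ltW.
  have -> : `]a, b]%classic = `]-oo, b] `\` `]-oo, a] :> set R.
    apply/seteqP; split => x /=; rewrite !in_itv/=.
      by move=> /andP[ax xb]; split => //; apply/negP; rewrite -ltNge.
    by move=> [xb /negP]; rewrite -ltNge => ->.
  have sab : `]-oo, a] `<=` (`]-oo, b]%classic : set R).
    by move=> x; rewrite /= !in_itv/= => /le_trans; apply.
  have m2oo : m2 `]-oo, b]%classic < +oo by rewrite -m12.
  have ma : measurable (`]-oo, a]%classic : set (measurableTypeR R)) by [].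
  have mb : measurable (`]-oo, b]%classic : set (measurableTypeR R)) by [].
  rewrite (measureD mb ma (m1oo b)) (measureD mb ma m2oo) (setIidr sab).
  by congr (_ - _); exact: m12.
pose g n : set (measurableTypeR R) := `](- n%:R)%R, n%:R]%classic.
have := @measure_unique _ R (measurableTypeR R) (@ocitv R) g erefl.
apply => //.
- exact: ocitvI.
- by move=> n; exists (- n%:R, n%:R)%R.
- apply/seteqP; split => // x _; exists (Num.truncn `|x|).+1 => //=.
  have := truncnS_gt `|x|; rewrite ltr_norml /g/= in_itv/= => /andP[-> h]; exact: ltW.
- by move=> _ [[a b] _ <-]; exact: mE.
- move=> n; apply: le_lt_trans (m1oo n%:R); apply: le_measure;
    rewrite ?inE; [exact: measurable_itv|exact: measurable_itv|].
  by move=> x; rewrite /g/= !in_itv/= => /andP[].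
Qed.

(** Since [X] avoids -oo, the distribution function sees only finite values and determines the
    restriction of the law to them; a possible mass at +oo is left out. *)
Lemma is_pdf_of_cdf (f : R -> R) : measurable_fun setT f -> (forall r, 0 <= f r)%R ->
  (forall w, -oo < X w) ->
  (forall r, ecdf P X r = \int[mu]_(x in `]-oo, r]) (f x)%:E) ->
  is_pdf P X f.
Proof.
move=> mf f0 XNy FE; split => // A mA.
have mX : measurable_fun setT X by exact: measurable_funP.
have mD : measurable (X @^-1` (EFin @` setT)).
  apply: (measurable_preimage mX); apply: measurable_image_EFin; exact: measurableT.
have mfX : measurable_fun setT (fun w => fine (X w) : measurableTypeR R).
  exact: measurableT_comp.
(* Restricting [P] to the event that [X] is finite discards the outcomes that [fine] would send to 0
   by default. *)
pose m1 := pushforward (mrestr P mD) (fun w => fine (X w) : measurableTypeR R).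
have m1E B : distribution P X (EFin @` B) = m1 B.
  rewrite /m1 /distribution /pushforward/= /mrestr; congr (P _).
  apply/seteqP; split => w /=.
    by move=> [x Bx xX]; rewrite -xX; split => //; exists x.
  by move=> [Bx [x _ xX]]; exists x => //; rewrite -xX in Bx.
pose m2 (B : set (measurableTypeR R)) := \int[mu]_(x in B) (f x)%:E.
have m20 : m2 set0 = 0 by rewrite /m2 integral_set0.
have m2_ge0 B : 0 <= m2 B by apply: integral_ge0 => x _; rewrite lee_fin.
have m2sa : semi_sigma_additive m2.
  by apply: semi_sigma_additive_nng_induced => //; exact/measurable_EFinP.
pose M2 : {measure set (measurableTypeR R) -> \bar R} :=
  HB.pack m2 (isMeasure.Build _ _ _ m2 m20 m2_ge0 m2sa).
have e12 r : m1 `]-oo, r]%classic = M2 `]-oo, r]%classic.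
  rewrite -m1E -[RHS]/(\int[mu]_(x in `]-oo, r]) (f x)%:E) -FE /ecdf.
  rewrite /distribution /pushforward; congr (P _).
  apply/seteqP; split => w /=.
    by move=> [x]; rewrite !in_itv/= => xr <-; rewrite lee_fin.
  rewrite in_itv/=; have := XNy w; case: (X w) => [x| |]// _ xr.
  by exists x => //; rewrite in_itv/= -lee_fin.
rewrite m1E -[RHS]/(M2 A); apply: finite_measure_eq_ocitv => // r.
suff h : m1 `]-oo, r]%classic <= 1 by exact: le_lt_trans h (ltry _).
by rewrite -m1E; apply: probability_le1; apply: measurable_image_EFin; exact: measurable_itv.
Qed.

End pdf_of_cdf.

(** * Integrating the density back to the distribution function *)

Section gamma_opt_pdf.
Context {R : realType}.
Notation mu := (@lebesgue_measure R).
Implicit Types (a b r t g : R).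
Variables (L : {measure set (R * R) -> \bar R}) (lam : R * R -> R) (d : R).
Hypotheses (L_density : has_density L lam) (lam_continuous : continuous lam)
  (L_fin : forall r, L (disc r) \is a fin_num) (L_isotropic : isotropic L)
  (d_gt0 : 0 < d).

Let M r := fine (L (disc r)).
Let kernel g t := g * polar_radius d g t /
  Num.sqrt (g ^+ 2 - d ^+ 2 * sin t ^+ 2) * radial lam (polar_radius d g t).

(* The truncation [Num.max g d] makes both factors continuous on the whole
   line. *)
Let G g := \int[mu]_(t in `[0, pi / 2]) kernel (Num.max g d) t.
Let H g := \int[mu]_(t in `[0, pi / 2]) M (polar_radius d (Num.max g d) t).

Definition gamma_density (g : R) :=
  4 * (\int[mu]_(t in `[0, pi / 2]) kernel g t) *
  expR (- (4 * \int[mu]_(t in `[0, pi / 2])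
    \int[mu]_(s in `[0, polar_radius d g t]) (radial lam s * s))) *
  (d <= g)%R%:R.

Let gamma_density_ext g := 4 * G g * expR (- (2 / pi * H g)).

(** By [integral_radial] the inner integral is a disc mass over [2 * pi], so the factor 4 becomes
    the 2 / pi of the distribution function. *)
Let gamma_densityE g : gamma_density g = gamma_density_ext g * (d <= g)%R%:R.
Proof.
rewrite /gamma_density; have [dg|//] := boolP (d <= g); last by rewrite !mulr0.
have pi0 := @pi_gt0 R.
rewrite /gamma_density_ext /G /H max_l//; congr (_ * expR (- _) * _).
transitivity (4 * \int[mu]_(t in `[0, pi / 2]) (M (polar_radius d g t) / (2 * pi))).
  congr (_ * _); apply: eq_Rintegral => t; rewrite inE/= in_itv/= => tI.
  by rewrite (integral_radial L_density)// polar_radius_ge0// cos_ge0_quadrant.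
rewrite RintegralZr//; last first.
  apply: (@bounded_itv_integrable _ _ _ _ (M g)); first exact: measurable_disc_mass.
  by move=> t tI; apply: disc_mass_bounded.
set I := \int[_]_(_ in _) _.
by move: (pi : R) pi0 => p p0; field; rewrite gt_eqF.
Qed.

Let continuous_gamma_density_ext : continuous gamma_density_ext.
Proof.
move=> g; apply: cvgM.
  apply: cvgMr; exact: (continuous_kernel_integral L_density lam_continuous d_gt0).
have cH := @continuous_mass_integral R L lam d L_density lam_continuous L_fin L_isotropic d_gt0 g.
have cN : - (2 / pi * H x) @[x --> g] --> - (2 / pi * H g).
  by apply: cvgN; apply: cvgMr; exact: cH.
exact: (cvg_comp _ _ cN (@continuous_expR R _)).
Qed.

Lemma measurable_gamma_density : measurable_fun setT gamma_density.
Proof.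
rewrite (_ : gamma_density = fun g => gamma_density_ext g * \1_(`[d, +oo[%classic) g).
  apply: measurable_funM; first exact: continuous_measurable_fun continuous_gamma_density_ext.
  exact: measurable_indic.
apply/funext => g; rewrite gamma_densityE indicE; congr (_ * _%:R).
by congr nat_of_bool; apply/idP/idP; rewrite inE/= in_itv/= andbT.
Qed.

Let gamma_density_ext_ge0 g : 0 <= gamma_density_ext g.
Proof.
rewrite mulr_ge0 ?expR_ge0// mulr_ge0//; apply: Rintegral_ge0 => t.
rewrite /= in_itv/= => tI.
have [C C0 HC] := kernel_bounded L_density lam_continuous d_gt0 (Num.max g d).
have dm : d <= Num.max g d by rewrite le_max lexx orbT.
by have /andP[] := HC _ _ dm (lexx _) tI.
Qed.

Lemma gamma_density_ge0 g : 0 <= gamma_density g.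
Proof. by rewrite gamma_densityE mulr_ge0 ?gamma_density_ext_ge0. Qed.

Lemma integral_gamma_density r :
  (\int[mu]_(g in `]-oo, r]) (gamma_density g)%:E)%E =
  (if r < d then 0
   else 1 - expR (- (2 / pi * \int[mu]_(t in `[0, pi / 2]) M (polar_radius d r t))))%:E.
Proof.
have pi0 := @pi_gt0 R.
have [rd|dr] := ltP r d.
  rewrite integral0_eq// => g; rewrite /= in_itv/= => gr.
  by rewrite gamma_densityE leNgt (le_lt_trans gr rd) mulr0.
transitivity (\int[mu]_(g in `[d, r]) (gamma_density_ext g)%:E)%E.
  rewrite integral_mkcond [RHS]integral_mkcond; apply: eq_integral => g _.
  rewrite !patchE gamma_densityE.
  have -> : (g \in (`]-oo, r]%classic : set R)) = (g <= r).
    by apply/idP/idP; rewrite inE/= in_itv.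
  have -> : (g \in (`[d, r]%classic : set R)) = (d <= g) && (g <= r).
    by apply/idP/idP; rewrite inE/= in_itv.
  by case: (d <= g); rewrite ?mulr1 ?mulr0//=; case: ifP.
(* The untruncated [F] is convenient to differentiate beyond [d]; it agrees from [d] on with a
   truncated, continuous version, whence its right limit at [d]. *)
pose F g := 1 - expR (- (2 / pi * \int[mu]_(t in `[0, pi / 2]) M (polar_radius d g t))).
have FE x : d <= x -> F x = 1 - expR (- (2 / pi * H x)) by move=> dx; rewrite /F /H max_l.
have HE x : d <= x -> \int[mu]_(t in `[0, pi / 2]) kernel x t = G x.
  by move=> dx; rewrite /G max_l.
(* At [g = d] every polar radius is |d cos t| - d cos t = 0, and the disc of radius 0 has no
   mass. *)
have Fd : F d = 0.
  rewrite FE// /H maxxx (_ : \int[_]_(_ in _) _ = \int[mu]_(t in `[0, pi / 2]) 0).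
    by rewrite Rintegral_cst// mul0r mulr0 oppr0 expR0 subrr.
  apply: eq_Rintegral => t; rewrite inE/= in_itv/= => tI.
  apply: (disc_mass_le0 L_density lam_continuous L_fin).
  rewrite /polar_radius polar_radicand subrr add0r sqrtr_sqr ger0_norm ?subrr//.
  by rewrite mulr_ge0 ?cos_ge0_quadrant// ltW.
have cF1 : continuous (fun g => 1 - expR (- (2 / pi * H g))).
  move=> x; apply: cvgB; first exact: cvg_cst.
  have cN : - (2 / pi * H y) @[y --> x] --> - (2 / pi * H x).
    apply: cvgN; apply: cvgMr.
    exact: (continuous_mass_integral L_density lam_continuous L_fin L_isotropic d_gt0).
  exact: (cvg_comp _ _ cN (@continuous_expR R _)).
have dF x : d < x -> is_derive x 1 F (gamma_density_ext x).
  move=> dx.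
  have D := is_derive_mass_integral L_density lam_continuous L_fin L_isotropic d_gt0 dx.
  have D1 : is_derive x 1
      (fun g => - (2 / pi * \int[mu]_(t in `[0, pi / 2]) M (polar_radius d g t)))
      (- (4 * G x)).
    apply: is_derive_eq; rewrite HE ?ltW// /GRing.scale/=.
    by move: (pi : R) pi0 => p p0; field; rewrite gt_eqF.
  have D2 := @is_derive1_comp R expR _ x _ _ (is_derive_expR _) D1.
  rewrite /F; apply: is_derive_eq.
  by rewrite /gamma_density_ext /H max_l ?ltW//; ring.
have [dr'|rd|<-] := ltgtP d r; last 2 first.
- by move: dr; rewrite leNgt rd.
- by rewrite set_itv1 integral_set1 -[RHS]/(F d)%:E Fd.
have cf := @continuous_subspaceT _ _ `[d, r]%classic _ continuous_gamma_density_ext.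
have Fr : F x @[x --> d^'+] --> F d.
  rewrite FE//; apply: cvg_trans (cvg_at_right_filter (cF1 d)).
  apply: near_eq_cvg; near=> x; rewrite FE//; near: x; exact: nbhs_right_ge.
have Fl : F x @[x --> r^'-] --> F r.
  apply: cvg_at_left_filter; have [dFr _] := dF r dr'.
  exact/differentiable_continuous/derivable1_diffP.
have dF' x : d < x < r -> is_derive x 1 F (gamma_density_ext x).
  by move=> /andP[dx _]; exact: dF.
by rewrite (FTC2_is_derive dr' cf Fr Fl dF') Fd subr0.
Unshelve. all: by end_near. Qed.

End gamma_opt_pdf.

Theorem theorem8 (R : realType) (disp : measure_display)
    (Omega : measurableType disp) (P : probability Omega R)
    (d : R) (Phi : point_process Omega R)
    (d_gt0 : 0 < d)
    (Phi_poisson : is_poisson_process P Phi)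
    (Lambda_locally_finite : locally_finite_measure (mean_measure P Phi))
    (Lambda_isotropic : isotropic (mean_measure P Phi)) :
  (forall gamma : R,
     ecdf P (gamma_opt d Phi) gamma =
     (if gamma < d then 0
      else 1 - expR (- (2 / pi *
        \int[lebesgue_measure]_(theta in `[0, pi / 2])
          fine (mean_measure P Phi (disc (polar_radius d gamma theta))))))%:E) /\
  (forall lam : R * R -> R,
     mean_measure P Phi `<< (lebesgue_measure \x lebesgue_measure)%E ->
     has_density (mean_measure P Phi) lam ->
     continuous lam ->
     (forall x : R * R, lam x = radial lam (enorm x)) /\
     is_pdf P (gamma_opt d Phi) (fun gamma : R =>
       4 * (\int[lebesgue_measure]_(theta in `[0, pi / 2])
              (gamma * polar_radius d gamma theta /
                 Num.sqrt (gamma ^+ 2 - d ^+ 2 * sin theta ^+ 2) *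
               radial lam (polar_radius d gamma theta))) *
       expR (- (4 *
         \int[lebesgue_measure]_(theta in `[0, pi / 2])
           \int[lebesgue_measure]_(psi in `[0, polar_radius d gamma theta])
             (radial lam psi * psi))) *
       (d <= gamma)%R%:R)).
Proof.
have cdf := gamma_opt_cdf d_gt0 Phi_poisson Lambda_locally_finite Lambda_isotropic.
split; first exact: cdf.
move=> lam _ L_density lam_continuous.
split; first exact: density_radial L_density lam_continuous Lambda_isotropic.
have L_fin := mean_measure_disc_fin Lambda_locally_finite.
apply: is_pdf_of_cdf.
- exact: (measurable_gamma_density L_density lam_continuous L_fin Lambda_isotropic d_gt0).
- exact: (gamma_density_ge0 L_density lam_continuous L_fin Lambda_isotropic d_gt0).
(* The lower bound [d] excludes the value -oo. *)
- by move=> w; apply: lt_le_trans (gamma_opt_ge _ d_gt0 w); exact: ltNyr.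
- move=> r; rewrite cdf; apply/esym.
  exact: (integral_gamma_density L_density lam_continuous L_fin Lambda_isotropic d_gt0).
Qed.
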